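(* Let $a, b \in \mathbb{C}\setminus\{0\}$, $c>0$, $c > |a|+|b|+1$, and $0<\lambda\le 1$. If $$\frac{\Gamma(c)\,\Gamma(c-|a|-|b|)}{\Gamma(c-|a|)\,\Gamma(c-|b|)}\left[\frac{|a|\,(|b|)_2}{(c-|a|)(c-|a|-|b|-1)}\;{}_2F_1(|a|+1,|b|+2;c-|a|+1;-1)+\lambda\;{}_2F_1(|a|,|b|;c-|a|;-1)\right]\le 2\lambda,$$ then the function $z\,{}_3F_2\left(a,\frac b2,\frac{b+1}2;\frac c2,\frac{c+1}2;z\right)$ belongs to the class $\mathcal{S}^*_\lambda$.
   Context: $\mathbb{D}=\{z\in\mathbb{C}:|z|<1\}$. $\mathcal{A}$ is the family of analytic functions $f$ on $\mathbb{D}$ of the form $f(z)=z+\sum_{n\ge2}a_nz^n$. For $\lambda>0$, $\mathcal{S}^*_\lambda=\{f\in\mathcal{A}: |zf'(z)/f(z)-1|<\lambda,\ z\in\mathbb{D}\}$. Pochhammer symbol: $(x)_0=1$, $(x)_n=x(x+1)\cdots(x+n-1)$ for $n\ge1$. Clausen's hypergeometric function is ${}_3F_2(a,b,c;d,e;z)=\sum_{n=0}^\infty\frac{(a)_n(b)_n(c)_n}{(d)_n(e)_n(1)_n}z^n$ for $|z|<1$, with $d,e\ne0,-1,-2,\dots$. ${}_2F_1(a,b;c;z)$ is the Gauss hypergeometric function, i.e. $\sum_{n\ge0}\frac{(a)_n(b)_n}{(c)_n(1)_n}z^n$ for $|z|<1$, continued analytically to $\mathbb{C}\setminus[1,\infty)$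 (so its value at $-1$ makes sense). *)

(* Defs.v *)
From Stdlib Require Import Reals.
From Coquelicot Require Import Coquelicot.
Open Scope R_scope.

Definition in_disk (z : C) : Prop := Cmod z < 1.

(* The complement of the real half-line [1, +oo). *)
Definition slit_plane (z : C) : Prop := ~ (Im z = 0 /\ 1 <= Re z).

(* Euler's integral; it converges exactly for [0 < x]. *)
Definition Gamma (x : R) : R :=
  RInt_gen (fun t => Rpower t (x - 1) * exp (- t))
           (at_right 0) (Rbar_locally p_infty).

Fixpoint poch (x : C) (n : nat) : C :=
  match n with
  | O => 1
  | S k => (poch x k * (x + INR k))%C
  end.

(* Sum of a complex power series, as a total function; it is the limit [l] of
   [is_pseries u z l] whenever there is one. *)
Definition C_PSeries (u : nat -> C) (z : C) : C :=
  (Series (fun n => Re (u n * z ^ n)), Series (fun n => Im (u n * z ^ n)))%C.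

(* The denominators are nonzero when the lower parameters avoid 0, -1, -2, ...;
   note that [poch 1 n] is [n!]. *)
Definition coef2F1 (a b c : C) (n : nat) : C :=
  (poch a n * poch b n / (poch c n * poch 1 n))%C.

Definition coef3F2 (a b c d e : C) (n : nat) : C :=
  (poch a n * poch b n * poch c n / (poch d n * poch e n * poch 1 n))%C.

(* Clausen's function, to be used on the unit disk only. *)
Definition hyp3F2 (a b c d e z : C) : C := C_PSeries (coef3F2 a b c d e) z.

Definition analytic_at (f : C -> C) (z0 : C) : Prop :=
  exists (u : nat -> C) (r : R), 0 < r /\
    forall z : C, Cmod (z - z0) < r -> is_pseries u (z - z0)%C (f z).

(* [F] is, on the slit plane, the analytic continuation of the Gauss series.
   As the slit plane is connected, this determines [F] there; the values of [F]
   on the cut are irrelevant. *)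
Definition is_hyp2F1 (a b c : C) (F : C -> C) : Prop :=
  (forall z : C, slit_plane z -> analytic_at F z) /\
  (forall z : C, in_disk z -> is_pseries (coef2F1 a b c) z (F z)).

(* Only the values of [f] on the disk matter. *)
Definition class_A (f : C -> C) : Prop :=
  exists u : nat -> C, u 0%nat = 0 /\ u 1%nat = 1 /\
    forall z : C, in_disk z -> is_pseries u z (f z).

(* For [f] in [class_A] the quotient [z f'(z) / f(z)] has a removable
   singularity at 0, with value 1, so the condition at 0 reads [0 < lam].
   Elsewhere the quotient has to be defined, which forces [f z <> 0]
   (Coquelicot's complex division by 0 is total). *)
Definition class_Sstar (lam : R) (f : C -> C) : Prop :=
  class_A f /\
  forall z : C, in_disk z -> z <> 0 ->
    f z <> 0 /\ Cmod (z * C_derive f z / f z - 1) < lam.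

(* Main.v *)
(* It suffices that [sum (n + lam) B_n <= 2 lam], where
   [B_n = p_n w_(2n)], [p_n = (|a|)_n / n!] and [w_N = (|b|)_N / (c)_N]
   dominate the coefficients of the Clausen function; the strict inequality then
   comes from [|z| < 1]. As [sum n B_n] is, up to a factor, the same series for
   [|a|+1, |b|+2, c+2], everything rests on
   [sum B_n <= K 2F1(|a|, |b|; c-|a|; -1)], with [K] the Gamma quotient.
   With [T] the Gauss series [sum p_k w_k], the contiguous relations give
   [sum_k p_k w_(n+k) = T (|b|)_n / (c-|a|)_n], so for [0 <= x < 1]
   [T 2F1(|a|, |b|; c-|a|; -x) = sum_N w_N C_N(x)], where [C_N(x)] is the
   coefficient of [t^N] in [((1 + x t) (1 - t))^-|a|]. These coefficients are
   nonnegative, so partial sums can be compared as [x] tends to 1, where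
   [((1 + t) (1 - t))^-|a|] gives back [B_n]; only the continuity of the
   continuation at -1 is used. Finally [T <= K] by the log-convexity of
   [Gamma]. *)
Require Import Defs.
From Stdlib Require Import Reals Lra Lia.
From Coquelicot Require Import Coquelicot.
Open Scope R_scope.

(** The obstacle is that the Gauss series with parameters [|a|], [|b|], [c - |a|] need not converge
    at -1: its terms grow like [n^(2|a| + |b| - c - 1)], and for large [|a|] the assumption on [c]
    allows them not even to tend to 0. The value at -1 is then that of the continuation only, and no
    double series can be rearranged there. This is why the rearrangement is done at [-x] with
    [x < 1] and only finite partial sums are carried to [x = 1]. The signs of [C_N(x)] come from [(1
    + x t)(1 - t) = 1 - ((1 - x) t + x t^2)], whose power [-|a|] expands with nonnegative
    coefficients. The index [2n] comes from duplication, [(b/2)_n ((b+1)/2)_n = (b)_(2n) / 4^n]; the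
    powers of 4 cancel against those from [c]. For the shifted parameters,
    [(c + 2) - (|a| + 1) = c - |a| + 1] is the lower parameter of the first Gauss function, and
    [(c + 2) - (|a| + 1) - (|b| + 2) > 0], the condition for summing the series at 1, is the
    assumption [c > |a| + |b| + 1]. *)

(** * Improper integrals of nonnegative functions on the positive half-line *)

Lemma ex_RInt_continuous_pos (f : R -> R) (a b : R) :
  (forall t, 0 < t -> continuous f t) -> 0 < a -> 0 < b -> ex_RInt f a b.
Proof.
intros Hc Ha Hb; apply (@ex_RInt_continuous R_CompleteNormedModule).
intros z [Hz _]; apply Hc.
apply Rlt_le_trans with (2 := Hz); now apply Rmin_glb_lt.
Qed.

(** Integrals over compact intervals grow with the interval, so their supremum is the limit. That it
    dominates each of them later yields the positivity of [Gamma]. *)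
Lemma is_RInt_gen_bounded (f : R -> R) (M : R) :
  (forall t, 0 < t -> continuous f t) ->
  (forall t, 0 < t -> 0 <= f t) ->
  (forall a b, 0 < a -> a <= b -> RInt f a b <= M) ->
  exists l, is_RInt_gen f (at_right 0) (Rbar_locally p_infty) l /\
    forall a b, 0 < a -> a <= b -> RInt f a b <= l.
Proof.
intros Hc Hp HM.
set (E := fun y : R => exists a b, 0 < a /\ a <= b /\ y = RInt f a b).
destruct (completeness E) as [l [Hub Hlub]].
- exists M; intros y (a & b & Ha & Hab & ->); now apply HM.
- exists (RInt f 1 1), 1, 1; repeat split; lra.
- assert (Hle : forall a b, 0 < a -> a <= b -> RInt f a b <= l).
  { intros a b Ha Hab; apply Hub; exists a, b; auto. }
  exists l; split; [|exact Hle].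
  intros P [eps HP].
  destruct (Classical_Prop.classic (exists a b, 0 < a /\ a <= b /\ l - eps < RInt f a b))
    as [(a0 & b0 & Ha0 & Hab0 & Hgt)|Hno].
  2:{ exfalso; assert (H : l <= l - eps).
      { apply Hlub; intros y (a & b & Ha & Hab & ->).
        apply Rnot_lt_le; intros H; apply Hno; exists a, b; auto. }
      pose proof (cond_pos eps); lra. }
  apply (Filter_prod _ _ _ (fun a => 0 < a < a0) (fun b => b0 < b)).
  + exists (mkposreal a0 Ha0); intros y Hy Hy0; split; [exact Hy0|].
    apply Rabs_lt_between' in Hy; simpl in Hy; lra.
  + exists b0; auto.
  + intros a b Ha Hb; simpl.
    exists (RInt f a b : R); split.
    * apply (RInt_correct (V := R_CompleteNormedModule)), ex_RInt_continuous_pos; auto; lra.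
    * apply HP.
      assert (Hmono : RInt f a0 b0 <= RInt f a b).
      { assert (H1 : ex_RInt f a a0) by (apply ex_RInt_continuous_pos; auto; lra).
        assert (H2 : ex_RInt f a0 b0) by (apply ex_RInt_continuous_pos; auto; lra).
        assert (H3 : ex_RInt f b0 b) by (apply ex_RInt_continuous_pos; auto; lra).
        rewrite <- (RInt_Chasles f a a0 b); [|auto|now apply ex_RInt_Chasles with b0].
        rewrite <- (RInt_Chasles f a0 b0 b); auto.
        assert (H4 : 0 <= RInt f a a0) by (apply RInt_ge_0; auto; try lra; intros; apply Hp; lra).
        assert (H5 : 0 <= RInt f b0 b) by (apply RInt_ge_0; auto; try lra; intros; apply Hp; lra).
        unfold plus; simpl; lra. }
      specialize (Hle a b (proj1 Ha) ltac:(lra)).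
      apply Rabs_lt_between'; lra.
Qed.

Lemma filter_prod_pos :
  filter_prod (at_right 0) (Rbar_locally p_infty)
    (fun ab => 0 < fst ab /\ fst ab <= snd ab).
Proof.
apply (Filter_prod _ _ _ (fun a => 0 < a < 1) (fun b => 1 < b)).
- exists (mkposreal 1 Rlt_0_1); intros y Hy Hy0; split; [exact Hy0|].
  apply Rabs_lt_between' in Hy; simpl in Hy; lra.
- exists 1; auto.
- simpl; intros; lra.
Qed.

Lemma is_RInt_gen_pos_ext (f g : R -> R) (l : R) :
  (forall t, 0 < t -> f t = g t) ->
  is_RInt_gen f (at_right 0) (Rbar_locally p_infty) l ->
  is_RInt_gen g (at_right 0) (Rbar_locally p_infty) l.
Proof.
intros Heq; apply is_RInt_gen_ext.
apply filter_imp with (2 := filter_prod_pos).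
intros [a b] [Ha Hab] x; simpl in *; rewrite Rmin_left by lra.
intros Hx; apply Heq; lra.
Qed.

Lemma is_RInt_gen_pos_ge_0 (f : R -> R) (l : R) :
  (forall t, 0 < t -> 0 <= f t) ->
  is_RInt_gen f (at_right 0) (Rbar_locally p_infty) l -> 0 <= l.
Proof.
intros Hp Hf.
apply Rle_trans with (norm l); [apply norm_ge_0|].
(* Here [f] serves as the majorant of its own norm, which gives [norm l <= l]. *)
apply (RInt_gen_norm (V := R_CompleteNormedModule) (Fa := at_right 0)
  (Fb := Rbar_locally p_infty) f f); auto.
- apply filter_imp with (2 := filter_prod_pos); tauto.
- apply filter_imp with (2 := filter_prod_pos).
  intros [a b] [Ha Hab] x Hx; simpl in *.
  apply Req_le, Rabs_pos_eq, Hp; lra.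
Qed.

(** * The Gamma function: convergence, functional equation, Chebyshev's inequality *)

Definition Gamma_integrand (x t : R) : R := Rpower t (x - 1) * exp (- t).

Lemma Gamma_integrand_pos (x t : R) : 0 < Gamma_integrand x t.
Proof. apply Rmult_lt_0_compat; apply exp_pos. Qed.

Lemma Gamma_integrand_continuous (x t : R) :
  0 < t -> continuous (Gamma_integrand x) t.
Proof.
intros Ht; apply (ex_derive_continuous (Gamma_integrand x)).
unfold Gamma_integrand, Rpower; auto_derive; lra.
Qed.

(* [e^-t <= C (1+t)^-(x+1)], and [t^(x-1) (1+t)^-(x+1)] is the derivative of
   the bounded function [(t/(1+t))^x / x]. *)
Lemma Gamma_integrand_RInt_bounded (x : R) : 0 < x ->
  exists M, forall a b, 0 < a -> a <= b -> RInt (Gamma_integrand x) a b <= M.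
Proof.
intros Hx.
(* An upper bound for [e^-t (1+t)^(x+1)], whose maximum, at [t = x], is
   [exp ((x + 1) * ln (x + 1) - x)]. *)
set (K := exp (x + (x + 1) * ln (x + 1))).
set (H := fun t => K / x * exp (x * (ln t - ln (1 + t)))).
set (h := fun t => K * exp ((x - 1) * ln t - (x + 1) * ln (1 + t))).
exists (K / x); intros a b Ha Hab.
assert (HK : 0 < K / x) by (apply Rdiv_lt_0_compat; [apply exp_pos|lra]).
assert (Hh : is_RInt h a b (H b - H a)).
{ apply is_RInt_derive with (f := H).
  - intros t; rewrite Rmin_left, Rmax_right by lra; intros Ht.
    unfold H; auto_derive; [lra|]; unfold h.
    replace (x * (ln t + - ln (1 + t)))
      with (((x - 1) * ln t - (x + 1) * ln (1 + t)) + (ln t + ln (1 + t))) by ring.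
    rewrite !exp_plus, !exp_ln by lra; field; lra.
  - intros t; rewrite Rmin_left, Rmax_right by lra; intros Ht.
    apply (ex_derive_continuous h); unfold h; auto_derive; lra. }
apply Rle_trans with (RInt h a b).
- apply RInt_le; [exact Hab| | |].
  + apply ex_RInt_continuous_pos; try lra; apply Gamma_integrand_continuous.
  + eexists; exact Hh.
  + intros t Ht; unfold Gamma_integrand, h, Rpower, K.
    rewrite <- !exp_plus.
    (* The tangent line of [ln] at [x + 1]: after multiplication by [x + 1] its slope is exactly
       what [exp (- t)] compensates. *)
    assert (Hln : ln (1 + t) <= t / (x + 1) - x / (x + 1) + ln (x + 1)).
    { replace (1 + t) with ((1 + t) / (x + 1) * (x + 1)) at 1 by (field; lra).
      rewrite ln_mult; [|apply Rdiv_lt_0_compat; lra|lra].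
      apply Rplus_le_compat_r.
      set (u := (1 + t) / (x + 1)).
      replace (t / (x + 1) - x / (x + 1)) with (u - 1) by (unfold u; field; lra).
      rewrite <- (ln_exp (u - 1)).
      apply ln_le; [apply Rdiv_lt_0_compat; lra|].
      pose proof (exp_ineq1_le (u - 1)); lra. }
    apply Rmult_le_compat_l with (r := x + 1) in Hln; [|lra].
    replace ((x + 1) * (t / (x + 1) - x / (x + 1) + ln (x + 1)))
      with (t - x + (x + 1) * ln (x + 1)) in Hln by (field; lra).
    assert (Hexp : forall u v, u <= v -> exp u <= exp v).
    { intros u v [Huv| ->]; [left; now apply exp_increasing|right; auto]. }
    apply Hexp; lra.
- rewrite (is_RInt_unique _ _ _ _ Hh).
  assert (H1 : 0 < H a) by (apply Rmult_lt_0_compat; [auto|apply exp_pos]).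
  assert (H2 : H b <= K / x * 1).
  { apply Rmult_le_compat_l; [lra|].
    apply Rle_trans with (exp 0); [left; apply exp_increasing|rewrite exp_0; lra].
    assert (ln b < ln (1 + b)) by (apply ln_increasing; lra).
    nra. }
  lra.
Qed.

(** [RInt_gen] is a total function, so a value of [Gamma] carries information only once convergence
    is known. Positivity is read off the interval from 1 to 2. *)
Lemma Gamma_spec (x : R) : 0 < x ->
  is_RInt_gen (Gamma_integrand x) (at_right 0) (Rbar_locally p_infty) (Gamma x) /\
  0 < Gamma x.
Proof.
intros Hx.
destruct (Gamma_integrand_RInt_bounded x Hx) as [M HM].
destruct (is_RInt_gen_bounded (Gamma_integrand x) M) as [l [Hl Hle]]; auto.
- intros; now apply Gamma_integrand_continuous.
- intros; apply Rlt_le, Gamma_integrand_pos.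
- replace (Gamma x) with l.
  2:{ symmetry; apply is_RInt_gen_unique; exact Hl. }
  split; [exact Hl|].
  apply Rlt_le_trans with (2 := Hle 1 2 Rlt_0_1 ltac:(lra)).
  apply RInt_gt_0; [lra| |].
  + intros; apply Gamma_integrand_pos.
  + intros t Ht; apply Gamma_integrand_continuous; lra.
Qed.

Lemma Gamma_pos (x : R) : 0 < x -> 0 < Gamma x.
Proof. apply Gamma_spec. Qed.

Lemma filterlim_Rpower_exp_0 (x : R) : 0 < x ->
  filterlim (fun t => Rpower t x * exp (- t)) (at_right 0) (locally 0).
Proof.
intros Hx P [eps HP].
exists (mkposreal (Rpower eps (/ x)) (exp_pos _)); intros t Ht Ht0.
apply HP; apply Rabs_lt_between'; simpl.
assert (H1 : 0 < Rpower t x) by apply exp_pos.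
assert (H2 : 0 < exp (- t) <= 1).
{ split; [apply exp_pos|rewrite <- exp_0; left; apply exp_increasing; lra]. }
assert (H3 : Rpower t x < eps).
{ apply Rabs_lt_between' in Ht; simpl in Ht.
  replace (pos eps) with (Rpower (Rpower eps (/ x)) x).
  - apply Rlt_Rpower_l; [exact Hx|lra].
  - rewrite Rpower_mult, Rinv_l, Rpower_1; try lra; apply cond_pos. }
split; [|nra].
assert (0 < Rpower t x * exp (- t)) by (apply Rmult_lt_0_compat; lra).
pose proof (cond_pos eps); lra.
Qed.

Lemma filterlim_Rpower_exp_infty (x : R) : 0 < x ->
  filterlim (fun t => Rpower t x * exp (- t)) (Rbar_locally p_infty) (locally 0).
Proof.
intros Hx.
apply filterlim_ext_loc with (fun t => exp (t * (x * (ln t / t) - 1))).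
- exists 0; intros t Ht; unfold Rpower; rewrite <- exp_plus; f_equal; field; lra.
- change (is_lim (fun t => exp (t * (x * (ln t / t) - 1))) p_infty 0).
  apply (is_lim_comp exp _ p_infty 0 m_infty).
  + apply is_lim_exp_m.
  + replace m_infty with (Rbar_mult p_infty (-1)).
    * apply is_lim_mult; [apply is_lim_id| |simpl; lra].
      replace (-1) with (x * 0 - 1) by ring.
      apply (is_lim_minus _ _ _ (x * 0) 1); [|apply is_lim_const|reflexivity].
      apply (is_lim_scal_l _ x p_infty 0), is_lim_div_ln_p.
    * simpl; destruct (Rle_dec 0 (-1)) as [r|r]; [exfalso; lra|reflexivity].
  + exists 0; intros; discriminate.
Qed.

(** Integration by parts: [t^x e^-t] vanishes at both ends, and its derivative is the difference of
    the two integrands. *)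
Lemma Gamma_succ (x : R) : 0 < x -> Gamma (x + 1) = x * Gamma x.
Proof.
intros Hx.
set (h := fun t => Rpower t x * exp (- t)).
assert (Hd : forall t, 0 < t ->
  is_derive h t (x * Gamma_integrand x t - Gamma_integrand (x + 1) t)).
{ intros t Ht; unfold h, Gamma_integrand, Rpower; auto_derive; [lra|].
  replace ((x - 1) * ln t) with (x * ln t - ln t) by ring.
  replace ((x + 1 - 1) * ln t) with (x * ln t) by ring.
  unfold Rminus; rewrite exp_plus, (exp_Ropp (ln t)), exp_ln by lra; field; lra. }
assert (Hint : is_RInt_gen (Derive h) (at_right 0) (Rbar_locally p_infty) (0 - 0)).
{ apply is_RInt_gen_Derive; try typeclasses eauto.
  - apply filter_imp with (2 := filter_prod_pos).
    intros [a b] [Ha Hab] t; simpl in *; rewrite Rmin_left by lra; intros Ht.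
    eexists; apply Hd; lra.
  - apply filter_imp with (2 := filter_prod_pos).
    intros [a b] [Ha Hab] t; simpl in *; rewrite Rmin_left by lra; intros Ht.
    apply (continuous_ext_loc (T := R_UniformSpace) (U := R_UniformSpace) _
      (fun t => x * Gamma_integrand x t - Gamma_integrand (x + 1) t)).
    + exists (mkposreal t ltac:(lra)); intros u Hu; symmetry.
      apply Rabs_lt_between' in Hu; simpl in Hu.
      apply is_derive_unique, Hd; lra.
    + apply (continuous_minus (V := R_NormedModule)
        (fun t => x * Gamma_integrand x t) (Gamma_integrand (x + 1))).
      * apply (continuous_scal_r (V := R_NormedModule) x (Gamma_integrand x)).
        apply Gamma_integrand_continuous; lra.
      * apply Gamma_integrand_continuous; lra.
  - now apply filterlim_Rpower_exp_0.
  - now apply filterlim_Rpower_exp_infty. }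
destruct (Gamma_spec x Hx) as [H1 _].
destruct (Gamma_spec (x + 1) ltac:(lra)) as [H2 _].
apply (is_RInt_gen_scal _ x) in H1.
pose proof (is_RInt_gen_minus _ _ _ _ H1 H2) as H3.
apply is_RInt_gen_pos_ext with (g := Derive h) in H3.
2:{ intros t Ht; symmetry; apply is_derive_unique, Hd, Ht. }
apply (is_RInt_gen_unique (V := R_CompleteNormedModule)) in H3.
apply (is_RInt_gen_unique (V := R_CompleteNormedModule)) in Hint.
rewrite Hint in H3; unfold minus, plus, opp, scal in H3; simpl in H3.
unfold mult in H3; simpl in H3; lra.
Qed.

(* Chebyshev's inequality for the measure [t^(s-p-q-1) e^-t dt]: with [tau^p]
   the mean of [t^p], integrate [(t^p - tau^p)(t^q - tau^q) >= 0]. *)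
Lemma Gamma_chebyshev (s p q : R) : 0 < p -> 0 < q -> 0 < s - p - q ->
  Gamma (s - p) * Gamma (s - q) <= Gamma s * Gamma (s - p - q).
Proof.
intros Hp Hq Hs.
destruct (Gamma_spec s ltac:(lra)) as [I1 P1].
destruct (Gamma_spec (s - p) ltac:(lra)) as [I2 P2].
destruct (Gamma_spec (s - q) ltac:(lra)) as [I3 P3].
destruct (Gamma_spec (s - p - q) ltac:(lra)) as [I4 P4].
set (m := Gamma (s - q) / Gamma (s - p - q)).
assert (Hm : 0 < m) by now apply Rdiv_lt_0_compat.
set (tau := Rpower m (/ p)).
assert (Htau : Rpower tau p = m).
{ unfold tau; rewrite Rpower_mult, Rinv_l, Rpower_1; lra. }
assert (Htau0 : 0 < tau) by apply exp_pos.
set (n := Rpower tau q).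
pose proof (is_RInt_gen_minus _ _ _ _ I1 (is_RInt_gen_scal _ m _ I2)) as J1.
pose proof (is_RInt_gen_minus _ _ _ _ (is_RInt_gen_scal _ (m * n) _ I4)
  (is_RInt_gen_scal _ n _ I3)) as J2.
pose proof (is_RInt_gen_plus _ _ _ _ J1 J2) as J.
apply is_RInt_gen_pos_ge_0 in J.
- unfold minus, plus, opp, scal in J; simpl in J; unfold mult in J; simpl in J.
  (* As [m] is the mean of [t^p], the integral of [t^p - m] is 0, so the terms with [n] cancel. *)
  replace (m * n * Gamma (s - p - q)) with (n * Gamma (s - q)) in J
    by (unfold m; field; lra).
  assert (Hle : m * Gamma (s - p) <= Gamma s) by lra.
  apply Rmult_le_compat_r with (r := Gamma (s - p - q)) in Hle; [|lra].
  replace (m * Gamma (s - p) * Gamma (s - p - q))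
    with (Gamma (s - p) * Gamma (s - q)) in Hle by (unfold m; field; lra).
  exact Hle.
- intros t Ht.
  set (w := Gamma_integrand (s - p - q) t).
  assert (Hw : 0 < w) by apply Gamma_integrand_pos.
  assert (Hfac : forall u, Gamma_integrand (s - p - q + u) t = Rpower t u * w).
  { intros u; unfold w, Gamma_integrand.
    replace (s - p - q + u - 1) with (u + (s - p - q - 1)) by ring.
    rewrite Rpower_plus; ring. }
  unfold minus, plus, opp, scal; simpl; unfold mult; simpl; fold w.
  assert (E1 : Gamma_integrand s t = Rpower t p * Rpower t q * w).
  { rewrite <- Rpower_plus, <- Hfac; f_equal; ring. }
  assert (E2 : Gamma_integrand (s - p) t = Rpower t q * w).
  { rewrite <- Hfac; f_equal; ring. }
  assert (E3 : Gamma_integrand (s - q) t = Rpower t p * w).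
  { rewrite <- Hfac; f_equal; ring. }
  rewrite E1, E2, E3.
  replace (Rpower t p * Rpower t q * w + - (m * (Rpower t q * w))
           + (m * n * w + - (n * (Rpower t p * w))))
    with (w * ((Rpower t p - m) * (Rpower t q - n))) by ring.
  apply Rmult_le_pos; [lra|].
  rewrite <- Htau; unfold n.
  destruct (Rle_lt_dec t tau) as [Hle|Hlt].
  + assert (Rpower t p <= Rpower tau p) by (apply Rle_Rpower_l; lra).
    assert (Rpower t q <= Rpower tau q) by (apply Rle_Rpower_l; lra).
    nra.
  + assert (Rpower tau p <= Rpower t p) by (apply Rle_Rpower_l; lra).
    assert (Rpower tau q <= Rpower t q) by (apply Rle_Rpower_l; lra).
    apply Rmult_le_pos; lra.
Qed.

(* [field] does not see through the algebraic structures of Coquelicot. *)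
Ltac real_eq := lazymatch goal with |- @eq _ ?x ?y => change (@eq R x y) end.

(** * Real Pochhammer symbols and their quotients *)

Fixpoint rpoch (x : R) (n : nat) : R :=
  match n with
  | O => 1
  | S k => rpoch x k * (x + INR k)
  end.

Lemma rpoch_pos (x : R) (n : nat) : 0 < x -> 0 < rpoch x n.
Proof.
intros Hx; induction n as [|n IH]; simpl; [lra|].
pose proof (pos_INR n); nra.
Qed.

Lemma rpoch_succ_shift (x : R) (n : nat) :
  x * rpoch (x + 1) n = rpoch x n * (x + INR n).
Proof.
induction n as [|n IH]; [simpl; ring|].
change (rpoch (x + 1) (S n)) with (rpoch (x + 1) n * (x + 1 + INR n)).
rewrite <- Rmult_assoc, IH, S_INR; simpl; ring.
Qed.

(* The coefficients of [(1 - t)^-al]. *)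
Definition binc (al : R) (n : nat) : R := rpoch al n / rpoch 1 n.

(* The moments of the beta distribution with parameters [be] and [c - be]. *)
Definition bmom (be c : R) (n : nat) : R := rpoch be n / rpoch c n.

Lemma binc_pos (al : R) (n : nat) : 0 < al -> 0 < binc al n.
Proof. intros; apply Rdiv_lt_0_compat; apply rpoch_pos; lra. Qed.

Lemma bmom_pos (be c : R) (n : nat) : 0 < be -> 0 < c -> 0 < bmom be c n.
Proof. intros; apply Rdiv_lt_0_compat; apply rpoch_pos; lra. Qed.

Lemma binc_S (al : R) (n : nat) :
  INR (S n) * binc al (S n) = (al + INR n) * binc al n.
Proof.
unfold binc; rewrite S_INR; simpl.
pose proof (pos_INR n); pose proof (rpoch_pos 1 n Rlt_0_1); field; lra.
Qed.

Lemma bmom_S (be c : R) (n : nat) : 0 < c ->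
  (c + INR n) * bmom be c (S n) = (be + INR n) * bmom be c n.
Proof.
intros Hc; unfold bmom; simpl.
pose proof (pos_INR n); pose proof (rpoch_pos c n Hc); field; lra.
Qed.

(** * Positive series, and the contiguous relations of the Gauss series at 1 *)

Lemma ex_series_bounded (a : nat -> R) (M : R) :
  (forall n, 0 <= a n) -> (forall n, sum_n a n <= M) -> ex_series a.
Proof.
intros Ha HM.
assert (H : ex_finite_lim_seq (sum_n a)).
{ apply ex_finite_lim_seq_incr with M; auto.
  intros n; rewrite sum_Sn; unfold plus; simpl; specialize (Ha (S n)); lra. }
destruct H as [l Hl]; exists l; exact Hl.
Qed.

Lemma is_series_ge_sum_n (a : nat -> R) (l : R) (n : nat) :
  (forall k, 0 <= a k) -> is_series a l -> sum_n a n <= l.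
Proof.
intros Ha Hl.
apply (is_lim_seq_incr_compare (sum_n a) l); [exact Hl|].
intros k; rewrite sum_Sn; unfold plus; simpl; specialize (Ha (S k)); lra.
Qed.

Lemma sum_n_telescope (E : nat -> R) (n : nat) :
  sum_n (fun k => E k - E (S k)) n = E 0%nat - E (S n).
Proof.
induction n as [|n IH]; [now rewrite sum_O|].
rewrite sum_Sn, IH; unfold plus; simpl; ring.
Qed.

Lemma is_series_telescope (E : nat -> R) :
  is_lim_seq E 0 -> is_series (fun k => E k - E (S k)) (E 0%nat).
Proof.
intros HE.
change (is_lim_seq (sum_n (fun k => E k - E (S k))) (E 0%nat)).
apply (is_lim_seq_ext (fun n => E 0%nat - E (S n))).
{ intros n; symmetry; apply sum_n_telescope. }
replace (Finite (E 0%nat)) with (Finite (E 0%nat - 0)) by (f_equal; ring).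
apply is_lim_seq_minus'; [apply is_lim_seq_const|].
now apply is_lim_seq_incr_1 in HE.
Qed.

(* If [n a n] tended to [l > 0], each block [a (n+1) + ... + a (2n)] would be
   at least [l / 2]. *)
Lemma is_lim_seq_INR_mul_series (a : nat -> R) (K : nat) :
  (forall n, 0 <= a n) -> ex_series a ->
  (forall k, (K <= k)%nat -> INR (S k) * a (S k) <= INR k * a k) ->
  is_lim_seq (fun k => INR k * a k) 0.
Proof.
intros Ha [s Hs] Hdec.
set (E := fun k => INR k * a k).
assert (HE0 : forall k, 0 <= E k) by (intros; apply Rmult_le_pos; [apply pos_INR|auto]).
assert (Hlim : ex_finite_lim_seq (fun k => E (k + K)%nat)).
{ apply ex_finite_lim_seq_decr with 0.
  - intros n; apply (Hdec (n + K)%nat); lia.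
  - auto. }
destruct Hlim as [l Hl].
assert (Hge : forall k, (K <= k)%nat -> l <= E k).
{ intros k Hk; replace k with ((k - K) + K)%nat by lia.
  apply (is_lim_seq_decr_compare (fun k => E (k + K)%nat) l); [exact Hl|].
  intros n; apply (Hdec (n + K)%nat); lia. }
assert (Hl0 : 0 <= l).
{ apply (is_lim_seq_le (fun _ => 0) (fun k => E (k + K)%nat) 0 l); auto.
  apply is_lim_seq_const. }
assert (Hblock : forall n m, (K <= n)%nat -> (1 <= n)%nat -> (m <= n)%nat ->
  INR m * (l / (2 * INR n)) <= sum_n a (m + n) - sum_n a n).
{ intros n m Hn Hn1; induction m as [|m IH]; intros Hm.
  - simpl; lra.
  - change (S m + n)%nat with (S (m + n)); rewrite sum_Sn, S_INR.
    unfold plus; simpl.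
    specialize (IH ltac:(lia)).
    assert (Hn0 : 0 < INR n) by (apply lt_0_INR; lia).
    assert (H1 : l / (2 * INR n) <= a (S (m + n))).
    { specialize (Hge (S (m + n)) ltac:(lia)); unfold E in Hge.
      apply Rle_div_l; [lra|].
      apply Rle_trans with (1 := Hge); rewrite Rmult_comm.
      apply Rmult_le_compat_l; [auto|].
      replace (2 * INR n) with (INR (2 * n)) by (rewrite mult_INR; simpl; ring).
      apply le_INR; lia. }
    lra. }
assert (Hhalf : l / 2 <= 0).
{ replace 0 with (s - s) by ring.
  apply (is_lim_seq_le_loc (fun _ => l / 2) (fun n => sum_n a (n + n) - sum_n a n)
    (l / 2) (s - s)).
  - exists (S K); intros n Hn.
    replace (l / 2) with (INR n * (l / (2 * INR n))).
    + apply Hblock; lia.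
    + field; apply not_0_INR; lia.
  - apply is_lim_seq_const.
  - apply is_lim_seq_minus'; [|exact Hs].
    apply (is_lim_seq_subseq (sum_n a) s (fun n => (n + n)%nat)); [|exact Hs].
    apply eventually_subseq; intros; lia. }
replace l with 0 in Hl by lra.
apply (is_lim_seq_incr_n E K), Hl.
Qed.

(* Gosper's certificate for the Gauss series: [k binc k v k] telescopes to both
   contiguous relations used below. *)
Lemma gauss_telescope (al b c : R) (v : nat -> R) (k : nat) :
  0 < c -> (c + INR k) * v (S k) = (b + INR k) * v k ->
  INR k * (binc al k * v k) - INR (S k) * (binc al (S k) * v (S k)) =
  binc al k * v k * ((c - al - b) * INR k - al * b) / (c + INR k).
Proof.
intros Hc Hv.
rewrite <- (Rmult_assoc (INR (S k))), binc_S.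
replace (v (S k)) with ((b + INR k) * v k / (c + INR k)).
- field; pose proof (pos_INR k); lra.
- rewrite <- Hv; field; pose proof (pos_INR k); lra.
Qed.

(** For large [k] the difference [E k - E (S k)] of the certificate exceeds a fixed multiple of the
    term, so the telescoping sum bounds the partial sums. Convergence then forces [E] to 0, and the
    certificate sums to [E 0 = 0]. The sequence [v] is left general so that it can be
    [bmom be c (n + k)], which satisfies the recurrence with [be + n] and [c + n]. *)
Lemma gauss_series (al b c : R) (v : nat -> R) :
  0 < al -> 0 < b -> al + b < c -> (forall k, 0 < v k) ->
  (forall k, (c + INR k) * v (S k) = (b + INR k) * v k) ->
  ex_series (fun k => binc al k * v k) /\
  is_series (fun k => binc al k * v k * ((c - al - b) * INR k - al * b) / (c + INR k)) 0.
Proof.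
intros Hal Hb Hc Hv Hrec.
set (a := fun k => binc al k * v k).
set (E := fun k => INR k * a k).
set (d := c - al - b).
assert (Hd : 0 < d) by (unfold d; lra).
assert (Ha : forall k, 0 < a k) by (intros; apply Rmult_lt_0_compat; [now apply binc_pos|auto]).
assert (HE : forall k, E k - E (S k) = a k * (d * INR k - al * b) / (c + INR k)).
{ intros k; unfold E, a; apply gauss_telescope; [lra|auto]. }
assert (HE0 : forall k, 0 <= E k).
{ intros; apply Rmult_le_pos; [apply pos_INR|now apply Rlt_le]. }
(* Beyond this [K], [d * k - al * b] is at least [d / 2 * (c + k)]. *)
destruct (INR_unbounded ((2 * al * b + d * c) / d)) as [K HK].
assert (Hgain : forall k, (K <= k)%nat -> d / 2 * a k <= E k - E (S k)).
{ intros k Hk; rewrite HE.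
  apply le_INR in Hk; pose proof (pos_INR k).
  assert (Hk2 : 2 * al * b + d * c < d * INR k).
  { apply Rlt_div_l in HK; [|lra]; nra. }
  replace (a k * (d * INR k - al * b) / (c + INR k))
    with (a k * ((d * INR k - al * b) / (c + INR k))) by (field; lra).
  rewrite Rmult_comm; apply Rmult_le_compat_l; [now apply Rlt_le|].
  apply (proj1 (Rle_div_r (d / 2) _ (c + INR k) ltac:(lra))); lra. }
assert (Hex : ex_series a).
{ apply (ex_series_incr_n a K), ex_series_bounded with (2 / d * E K).
  - intros; now apply Rlt_le.
  - intros n.
    apply Rle_trans with
      (sum_n (fun k => 2 / d * (E (K + k)%nat - E (S (K + k)))) n).
    + apply sum_n_m_le; intros k; specialize (Hgain (K + k)%nat ltac:(lia)).
      replace (a (K + k)%nat) with (2 / d * (d / 2 * a (K + k)%nat)) by (field; lra).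
      apply Rmult_le_compat_l; [|exact Hgain].
      apply Rlt_le, Rdiv_lt_0_compat; lra.
    + rewrite (sum_n_ext _ (fun k => scal (2 / d)
        ((fun j => E (K + j)%nat) k - (fun j => E (K + j)%nat) (S k)))).
      2:{ intros k; unfold scal; simpl; unfold mult; simpl.
          now replace (K + S k)%nat with (S (K + k)) by lia. }
      rewrite (sum_n_scal_l (K := R_Ring) (V := R_ModuleSpace)).
      rewrite (sum_n_telescope (fun j => E (K + j)%nat)).
      unfold scal; simpl; unfold mult; simpl.
      apply Rmult_le_compat_l; [apply Rlt_le, Rdiv_lt_0_compat; lra|].
      rewrite Nat.add_0_r; specialize (HE0 (K + S n)%nat); lra. }
split; [exact Hex|].
apply (is_series_ext (fun k => E k - E (S k))).
{ intros k; apply HE. }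
assert (E00 : E 0%nat = 0) by (unfold E; simpl; ring).
rewrite <- E00; apply is_series_telescope, is_lim_seq_INR_mul_series with K; auto.
- intros; now apply Rlt_le.
- intros k Hk; specialize (Hgain k Hk); specialize (Ha k); unfold E in Hgain; nra.
Qed.

Definition shifted_gauss (al be c : R) (n : nat) : R :=
  Series (fun k => binc al k * bmom be c (n + k)).

Lemma ex_series_shifted_gauss (al be c : R) (n : nat) :
  0 < al -> 0 < be -> al + be < c ->
  is_series (fun k => binc al k * bmom be c (n + k)) (shifted_gauss al be c n).
Proof.
intros Hal Hbe Hc; apply Series_correct.
pose proof (pos_INR n).
apply (gauss_series al (be + INR n) (c + INR n)); try lra.
- intros; apply bmom_pos; lra.
- intros k; rewrite Nat.add_succ_r, !Rplus_assoc, <- !plus_INR.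
  apply bmom_S; lra.
Qed.

Lemma shifted_gauss_pos (al be c : R) (n : nat) :
  0 < al -> 0 < be -> al + be < c -> 0 < shifted_gauss al be c n.
Proof.
intros Hal Hbe Hc.
pose proof (ex_series_shifted_gauss al be c n Hal Hbe Hc) as H.
apply is_series_ge_sum_n with (n := 0%nat) in H.
- rewrite sum_O in H; apply Rlt_le_trans with (2 := H).
  apply Rmult_lt_0_compat; [now apply binc_pos|apply bmom_pos; lra].
- intros; apply Rlt_le, Rmult_lt_0_compat; [now apply binc_pos|apply bmom_pos; lra].
Qed.

(** Both sides satisfy [(c - al + n) S(n+1) = (be + n) S(n)]. For the left side the difference is,
    term by term, the certificate with [be + n] and [c + n], because [(C - al)(B + k) - B (C + k) =
    (C - al - B) k - al B]. *)
Lemma shifted_gauss_eq (al be c : R) (n : nat) :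
  0 < al -> 0 < be -> al + be < c ->
  shifted_gauss al be c n = shifted_gauss al be c 0 * bmom be (c - al) n.
Proof.
intros Hal Hbe Hc; induction n as [|n IH].
{ unfold bmom; simpl; field. }
assert (Hn := pos_INR n).
apply Rmult_eq_reg_l with (c - al + INR n); [|lra].
replace ((c - al + INR n) * (shifted_gauss al be c 0 * bmom be (c - al) (S n)))
  with (shifted_gauss al be c 0 * ((c - al + INR n) * bmom be (c - al) (S n))) by ring.
rewrite bmom_S by lra.
replace (shifted_gauss al be c 0 * ((be + INR n) * bmom be (c - al) n))
  with ((be + INR n) * shifted_gauss al be c n) by (rewrite IH; ring).
apply Rminus_diag_uniq.
assert (Hrec : forall k, (c + INR n + INR k) * bmom be c (n + S k) =
                         (be + INR n + INR k) * bmom be c (n + k)).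
{ intros k; rewrite Nat.add_succ_r, !Rplus_assoc, <- !plus_INR.
  apply bmom_S; lra. }
assert (Hz : is_series (fun k =>
  (c - al + INR n) * (binc al k * bmom be c (S n + k)) -
  (be + INR n) * (binc al k * bmom be c (n + k))) 0).
{ destruct (gauss_series al (be + INR n) (c + INR n) (fun k => bmom be c (n + k)))
    as [_ Hz]; auto; try lra.
  { intros; apply bmom_pos; lra. }
  apply is_series_ext with (2 := Hz); intros k; simpl Nat.add.
  replace (bmom be c (S (n + k)))
    with ((be + INR n + INR k) * bmom be c (n + k) / (c + INR n + INR k)).
  - real_eq; field; pose proof (pos_INR k); lra.
  - rewrite <- Hrec, Nat.add_succ_r; field; pose proof (pos_INR k); lra. }
pose proof (is_series_minus _ _ _ _
  (is_series_scal_l (c - al + INR n) _ _ (ex_series_shifted_gauss al be c (S n) Hal Hbe Hc))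
  (is_series_scal_l (be + INR n) _ _ (ex_series_shifted_gauss al be c n Hal Hbe Hc))) as H.
apply is_series_unique in H; apply is_series_unique in Hz.
rewrite <- Hz at 1; symmetry; exact H.
Qed.

Definition gauss_sum (al be c : R) : R := shifted_gauss al be c 0.

(** Raising [c] by 1 multiplies the term of index [k] by [c / (c + k)], so after division by [c] the
    difference of the two sides is again the certificate series, of sum 0. *)
Lemma gauss_sum_contiguous (al be c : R) :
  0 < al -> 0 < be -> al + be < c ->
  c * (c - al - be) * gauss_sum al be c =
  (c - al) * (c - be) * gauss_sum al be (c + 1).
Proof.
intros Hal Hbe Hc.
destruct (gauss_series al be c (bmom be c)) as [_ Hz]; auto; try lra.
{ intros; apply bmom_pos; lra. }
{ intros; apply bmom_S; lra. }
pose proof (is_series_minus _ _ _ _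
  (is_series_scal_l (c - al - be) _ _ (ex_series_shifted_gauss al be c 0 Hal Hbe Hc))
  (is_series_scal_l ((c - al) * (c - be) / c) _ _
     (ex_series_shifted_gauss al be (c + 1) 0 Hal Hbe ltac:(lra)))) as H.
apply is_series_ext with
  (b := fun k => binc al k * bmom be c k * ((c - al - be) * INR k - al * be) / (c + INR k)) in H.
- apply is_series_unique in H; apply is_series_unique in Hz.
  rewrite Hz in H; unfold minus, plus, opp, scal in H; simpl in H; unfold mult in H; simpl in H.
  unfold gauss_sum.
  apply Rmult_eq_reg_r with (/ c); [|apply Rinv_neq_0_compat; lra].
  apply Rminus_diag_uniq; rewrite H at 1; field; lra.
- intros k; unfold minus, plus, opp, scal; simpl; unfold mult; simpl.
  unfold bmom.
  pose proof (rpoch_pos c k ltac:(lra)); pose proof (rpoch_pos (c + 1) k ltac:(lra)).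
  pose proof (pos_INR k).
  replace (rpoch (c + 1) k) with (rpoch c k * (c + INR k) / c).
  + field; lra.
  + rewrite <- rpoch_succ_shift; field; lra.
Qed.

(** The first term is 1, and every later one shrinks at least by the factor [c / (c + n)], the first
    factor of [(c)_k / (c + n)_k]. *)
Lemma gauss_sum_le (al be c : R) (n : nat) :
  0 < al -> 0 < be -> al + be < c ->
  gauss_sum al be (c + INR n) <= 1 + c / (c + INR n) * gauss_sum al be c.
Proof.
intros Hal Hbe Hc; pose proof (pos_INR n) as Hn.
pose proof (ex_series_shifted_gauss al be c 0 Hal Hbe Hc) as H1.
pose proof (ex_series_shifted_gauss al be (c + INR n) 0 Hal Hbe ltac:(lra)) as H2.
assert (Hr : 0 < c / (c + INR n)) by (apply Rdiv_lt_0_compat; lra).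
assert (Hk : forall k, bmom be (c + INR n) (S k) <= c / (c + INR n) * bmom be c (S k)).
{ induction k as [|k IH].
  - unfold bmom; simpl; right; field; lra.
  - set (m := S k) in *; pose proof (pos_INR m).
    pose proof (bmom_S be c m ltac:(lra)) as E1.
    pose proof (bmom_S be (c + INR n) m ltac:(lra)) as E2.
    pose proof (bmom_pos be (c + INR n) (S m) Hbe ltac:(lra)).
    pose proof (bmom_pos be (c + INR n) m Hbe ltac:(lra)).
    pose proof (bmom_pos be c m Hbe ltac:(lra)).
    apply Rmult_le_reg_l with (c + INR m); [lra|].
    apply Rle_trans with ((be + INR m) * bmom be (c + INR n) m).
    + rewrite <- E2; apply Rmult_le_compat_r; lra.
    + replace ((c + INR m) * (c / (c + INR n) * bmom be c (S m)))
        with (c / (c + INR n) * ((c + INR m) * bmom be c (S m))) by ring.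
      rewrite E1.
      replace (c / (c + INR n) * ((be + INR m) * bmom be c m))
        with ((be + INR m) * (c / (c + INR n) * bmom be c m)) by ring.
      apply Rmult_le_compat_l; lra. }
unfold gauss_sum, shifted_gauss.
rewrite Series_incr_1 by (eexists; exact H2).
apply Rplus_le_compat.
- unfold binc, bmom; simpl; right; field.
- rewrite <- Series_scal_l.
  assert (H0 : forall k, 0 <= c / (c + INR n) * (binc al k * bmom be c (0 + k))).
  { intros k; apply Rmult_le_pos; [lra|].
    apply Rlt_le, Rmult_lt_0_compat; [now apply binc_pos|apply bmom_pos; lra]. }
  rewrite (Series_incr_1 (fun k => c / (c + INR n) * _)).
  2:{ apply (ex_series_scal_l (V := R_NormedModule) (c / (c + INR n))
        (fun k => binc al k * bmom be c (0 + k))); eexists; exact H1. }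
  assert (Hle : Series (fun k => binc al (S k) * bmom be (c + INR n) (0 + S k)) <=
    Series (fun k => c / (c + INR n) * (binc al (S k) * bmom be c (0 + S k)))).
  { apply Series_le.
    - intros k; pose proof (binc_pos al (S k) Hal); split.
      + apply Rlt_le, Rmult_lt_0_compat; [auto|apply bmom_pos; lra].
      + replace (c / (c + INR n) * (binc al (S k) * bmom be c (0 + S k)))
          with (binc al (S k) * (c / (c + INR n) * bmom be c (S k)))
          by (simpl Nat.add; ring).
        apply Rmult_le_compat_l; [lra|apply Hk].
    - apply (ex_series_incr_1 (fun k => c / (c + INR n) * (binc al k * bmom be c (0 + k)))).
      apply (ex_series_scal_l (V := R_NormedModule) (c / (c + INR n))
        (fun k => binc al k * bmom be c (0 + k))); eexists; exact H1. }
  specialize (H0 0%nat); lra.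
Qed.

(** * Gauss's summation theorem as an inequality *)

Definition gauss_Gamma (al be c : R) : R :=
  Gamma c * Gamma (c - al - be) / (Gamma (c - al) * Gamma (c - be)).

(** The relation of [gauss_sum_contiguous] again: the ratio of [gauss_sum] to [gauss_Gamma] does not
    change when [c] grows by 1. *)
Lemma gauss_Gamma_contiguous (al be c : R) :
  0 < al -> 0 < be -> al + be < c ->
  c * (c - al - be) * gauss_Gamma al be c =
  (c - al) * (c - be) * gauss_Gamma al be (c + 1).
Proof.
intros Hal Hbe Hc; unfold gauss_Gamma.
replace (c + 1 - al - be) with (c - al - be + 1) by ring.
replace (c + 1 - al) with (c - al + 1) by ring.
replace (c + 1 - be) with (c - be + 1) by ring.
rewrite !Gamma_succ by lra.
pose proof (Gamma_pos (c - al) ltac:(lra)); pose proof (Gamma_pos (c - be) ltac:(lra)).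
field; lra.
Qed.

Lemma gauss_Gamma_ge_1 (al be c : R) :
  0 < al -> 0 < be -> al + be < c -> 1 <= gauss_Gamma al be c.
Proof.
intros Hal Hbe Hc; unfold gauss_Gamma.
apply Rle_div_r.
- apply Rlt_gt, Rmult_lt_0_compat; apply Gamma_pos; lra.
- rewrite Rmult_1_l; apply Gamma_chebyshev; lra.
Qed.

(* Equality is Gauss's theorem; this direction needs no asymptotics of
   [Gamma], because [gauss_sum al be (c + n)] tends to 1 while
   [gauss_Gamma al be (c + n)] is at least 1. *)
Lemma gauss_sum_le_Gamma (al be c : R) :
  0 < al -> 0 < be -> al + be < c ->
  gauss_sum al be c <= gauss_Gamma al be c.
Proof.
intros Hal Hbe Hc.
assert (Hcross : forall n, gauss_sum al be c * gauss_Gamma al be (c + INR n) =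
                           gauss_Gamma al be c * gauss_sum al be (c + INR n)).
{ induction n as [|n IH]; [simpl; rewrite Rplus_0_r; ring|].
  pose proof (pos_INR n).
  pose proof (gauss_sum_contiguous al be (c + INR n) Hal Hbe ltac:(lra)) as E1.
  pose proof (gauss_Gamma_contiguous al be (c + INR n) Hal Hbe ltac:(lra)) as E2.
  rewrite S_INR, <- Rplus_assoc.
  apply Rmult_eq_reg_l with ((c + INR n - al) * (c + INR n - be)); [|nra].
  set (x := c + INR n) in *.
  transitivity (gauss_sum al be c * (x * (x - al - be) * gauss_Gamma al be x)).
  - rewrite E2; ring.
  - transitivity (gauss_Gamma al be c * (x * (x - al - be) * gauss_sum al be x)).
    + transitivity (x * (x - al - be) * (gauss_sum al be c * gauss_Gamma al be x)); [ring|].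
      rewrite IH; ring.
    + rewrite E1; ring. }
set (T := gauss_sum al be c) in *.
assert (HT : 0 < T) by now apply shifted_gauss_pos.
set (Q := gauss_Gamma al be c) in *.
assert (HQ : 1 <= Q) by now apply gauss_Gamma_ge_1.
replace Q with (Q * (1 + c * T * 0)) by ring.
apply (is_lim_seq_le (fun _ => T) (fun n => Q * (1 + c * T * / (c + INR n)))
  T (Q * (1 + c * T * 0))).
- intros n; pose proof (pos_INR n).
  apply Rle_trans with (T * gauss_Gamma al be (c + INR n)).
  + pose proof (gauss_Gamma_ge_1 al be (c + INR n) Hal Hbe ltac:(lra)); nra.
  + rewrite Hcross; apply Rmult_le_compat_l; [lra|].
    pose proof (gauss_sum_le al be c n Hal Hbe Hc) as Hle; fold T in Hle.
    replace (c * T * / (c + INR n)) with (c / (c + INR n) * T) by (field; lra).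
    exact Hle.
- apply is_lim_seq_const.
- apply is_lim_seq_mult'; [apply is_lim_seq_const|].
  apply is_lim_seq_plus'; [apply is_lim_seq_const|].
  apply is_lim_seq_mult'; [apply is_lim_seq_const|].
  apply (is_lim_seq_inv _ p_infty); [|discriminate].
  apply (is_lim_seq_plus _ _ c p_infty p_infty); [apply is_lim_seq_const|apply is_lim_seq_INR|reflexivity].
Qed.

(** * Finite sums and Tannery's theorem *)

Lemma sum_n_first (f : nat -> R) (n : nat) :
  sum_n f (S n) = f 0%nat + sum_n (fun k => f (S k)) n.
Proof.
induction n as [|n IH]; [rewrite sum_Sn, !sum_O; reflexivity|].
rewrite sum_Sn, IH, (sum_Sn _ n); unfold plus; simpl; ring.
Qed.

Lemma sum_n_ext_R (f g : nat -> R) (n : nat) :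
  (forall k, (k <= n)%nat -> f k = g k) -> sum_n f n = sum_n g n.
Proof. apply sum_n_ext_loc. Qed.

Lemma sum_n_scal_R (r : R) (f : nat -> R) (n : nat) :
  sum_n (fun k => r * f k) n = r * sum_n f n.
Proof. apply (sum_n_scal_l (K := R_Ring) (V := R_ModuleSpace)). Qed.

Lemma sum_n_plus_R (f g : nat -> R) (n : nat) :
  sum_n (fun k => f k + g k) n = sum_n f n + sum_n g n.
Proof. apply (sum_n_plus (G := R_AbelianMonoid)). Qed.

Lemma is_lim_seq_sum_n (g : nat -> nat -> R) (l : nat -> R) (N : nat) :
  (forall n, is_lim_seq (g n) (l n)) ->
  is_lim_seq (fun M => sum_n (fun n => g n M) N) (sum_n l N).
Proof.
intros H; induction N as [|N IH].
- rewrite sum_O; apply is_lim_seq_ext with (2 := H 0%nat).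
  intros; now rewrite sum_O.
- rewrite sum_Sn.
  apply is_lim_seq_ext with (fun M => sum_n (fun n => g n M) N + g (S N) M).
  { intros; now rewrite sum_Sn. }
  apply is_lim_seq_plus'; auto.
Qed.

(** Dominated convergence for a sum whose length grows with the parameter, as in [sum_n_triangle],
    where both the number of rows and their lengths depend on [M]. *)
Lemma is_lim_seq_tannery (g : nat -> nat -> R) (l h : nat -> R) :
  (forall n M, (n <= M)%nat -> Rabs (g n M) <= h n) ->
  ex_series h ->
  (forall n, is_lim_seq (g n) (l n)) ->
  is_lim_seq (fun M => sum_n (fun n => g n M) M) (Series l).
Proof.
intros Hg Hh Hl.
assert (Hlh : forall n, Rabs (l n) <= h n).
{ intros n.
  apply (is_lim_seq_le_loc (fun M => Rabs (g n M)) (fun _ => h n) (Rabs (l n)) (h n)).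
  - exists n; intros; now apply Hg.
  - apply (is_lim_seq_abs _ (l n)), Hl.
  - apply is_lim_seq_const. }
assert (Hls : is_series l (Series l)).
{ apply Series_correct.
  apply (ex_series_le (K := R_AbsRing) (V := R_CompleteNormedModule) l h); auto. }
assert (Htail : forall M N m, (N <= m <= M)%nat ->
  sum_n (fun n => Rabs (g n M - l n)) m <=
  sum_n (fun n => Rabs (g n M - l n)) N + 2 * (sum_n h m - sum_n h N)).
{ intros M N m [HN Hm]; induction HN as [|m HN IH]; [lra|].
  rewrite !(sum_Sn _ m); unfold plus; simpl.
  specialize (IH ltac:(lia)).
  assert (Rabs (g (S m) M - l (S m)) <= 2 * h (S m)).
  { unfold Rminus; eapply Rle_trans; [apply Rabs_triang|]; rewrite Rabs_Ropp.
    specialize (Hg (S m) M Hm); specialize (Hlh (S m)); lra. }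
  lra. }
assert (Hdiff : is_lim_seq (fun M => sum_n (fun n => g n M - l n) M) 0).
{ destruct Hh as [H HH].
  apply is_lim_seq_spec; intros eps.
  (* The head costs [eps / 8]; the tail costs twice a difference of two partial sums of [h], each
     within [eps / 8] of the limit. *)
  assert (He : 0 < eps / 8) by (pose proof (cond_pos eps); lra).
  change (is_lim_seq (sum_n h) H) in HH; apply is_lim_seq_spec in HH.
  destruct (HH (mkposreal _ He)) as [N HN]; simpl in HN.
  assert (Hfin : is_lim_seq (fun M => sum_n (fun n => Rabs (g n M - l n)) N) 0).
  { replace 0 with (sum_n (fun n => Rabs (l n - l n)) N).
    - apply (is_lim_seq_sum_n (fun n M => Rabs (g n M - l n))); intros n.
      apply (is_lim_seq_abs _ (l n - l n)).
      apply is_lim_seq_minus'; [apply Hl|apply is_lim_seq_const].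
    - transitivity (sum_n (fun n => 0) N).
      + apply sum_n_ext; intros n.
        unfold Rminus; rewrite Rplus_opp_r; apply Rabs_R0.
      + rewrite sum_n_const; real_eq; ring. }
  apply is_lim_seq_spec in Hfin.
  destruct (Hfin (mkposreal _ He)) as [N' HN']; simpl in HN'.
  exists (N + N')%nat; intros M HM.
  assert (H1 := HN N (le_n N)); assert (H2 := HN M ltac:(lia)).
  assert (H3 := HN' M ltac:(lia)).
  assert (H4 := Htail M N M ltac:(lia)).
  assert (H5 : Rabs (sum_n (fun n => g n M - l n) M) <= sum_n (fun n => Rabs (g n M - l n)) M).
  { apply (norm_sum_n_m (K := R_AbsRing) (V := R_NormedModule)). }
  apply Rabs_lt_between' in H1; apply Rabs_lt_between' in H2.
  apply Rabs_lt_between' in H3.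
  rewrite Rminus_0_r; lra. }
pose proof (is_lim_seq_plus' _ _ _ _ Hdiff Hls) as HH.
rewrite Rplus_0_l in HH; apply is_lim_seq_ext with (2 := HH).
intros M; rewrite <- (sum_n_plus_R (fun n => g n M - l n) l).
apply sum_n_ext; intros; simpl; real_eq; ring.
Qed.

(** * The coefficients of [((1 + x t) (1 - t))^-al] and their recurrence *)

Definition conv_weight (q : nat -> nat -> R) (al x : R) (N : nat) : R :=
  sum_n (fun n => q n (N - n)%nat * ((- x) ^ n * (binc al n * binc al (N - n)))) N.

(* The coefficients of [((1 + x t) (1 - t))^-al]. *)
Definition conv_binc : R -> R -> nat -> R := conv_weight (fun _ _ => 1).

(** The weight [n] stands for [t d/dt] acting on the factor [f = (1 + x t)^-al] alone, and this is
    [f' = - x (t f' + al f)] read on coefficients. The next lemma does the same for the other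
    factor, and [conv_weight_add] is the product rule. *)
Lemma conv_weight_fst_S (al x : R) (N : nat) :
  conv_weight (fun n _ => INR n) al x (S N) =
  - x * (conv_weight (fun n _ => INR n) al x N + al * conv_binc al x N).
Proof.
unfold conv_binc, conv_weight.
rewrite sum_n_first, <- (sum_n_scal_R al), <- sum_n_plus_R, <- sum_n_scal_R.
replace (INR 0 * _) with 0 by (simpl; ring); rewrite Rplus_0_l.
apply sum_n_ext_R; intros n Hn; simpl Nat.sub; rewrite <- tech_pow_Rmult.
replace (INR (S n) * (- x * (- x) ^ n * (binc al (S n) * binc al (N - n))))
  with (- x * (- x) ^ n * (INR (S n) * binc al (S n)) * binc al (N - n)) by ring.
rewrite binc_S; ring.
Qed.

Lemma conv_weight_snd_S (al x : R) (N : nat) :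
  conv_weight (fun _ k => INR k) al x (S N) =
  conv_weight (fun _ k => INR k) al x N + al * conv_binc al x N.
Proof.
unfold conv_binc, conv_weight.
rewrite sum_Sn, Nat.sub_diag, <- (sum_n_scal_R al), <- sum_n_plus_R.
unfold plus; simpl AbelianMonoid.plus.
replace (INR 0 * _) with 0 by (simpl; ring).
unfold AbelianMonoid.plus; simpl; rewrite Rplus_0_r.
apply sum_n_ext_R; intros n Hn.
replace (match n with O => S N | S l => (N - l)%nat end) with (S (N - n)) by (destruct n; lia).
replace (INR (S (N - n)) * ((- x) ^ n * (binc al n * binc al (S (N - n)))))
  with ((- x) ^ n * binc al n * (INR (S (N - n)) * binc al (S (N - n)))) by ring.
rewrite binc_S; ring.
Qed.

Lemma conv_weight_add (al x : R) (N : nat) :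
  conv_weight (fun n _ => INR n) al x N + conv_weight (fun _ k => INR k) al x N =
  INR N * conv_binc al x N.
Proof.
unfold conv_binc, conv_weight; rewrite <- sum_n_plus_R, <- sum_n_scal_R.
apply sum_n_ext_R; intros n Hn.
rewrite minus_INR by lia; ring.
Qed.

Lemma conv_binc_0 (al x : R) : conv_binc al x 0 = 1.
Proof.
unfold conv_binc, conv_weight; rewrite sum_O; unfold binc; simpl; field.
Qed.

Lemma conv_binc_1 (al x : R) : conv_binc al x 1 = al * (1 - x).
Proof.
unfold conv_binc, conv_weight; rewrite sum_Sn, sum_O; unfold plus, binc; simpl; field.
Qed.

(* With [y] the generating function, this is
   [y' (1 - (1 - x) t - x t^2) = al (1 - x + 2 x t) y]. *)
Lemma conv_binc_SS (al x : R) (N : nat) :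
  INR (S (S N)) * conv_binc al x (S (S N)) =
  (1 - x) * (INR (S N) + al) * conv_binc al x (S N) +
  x * (INR N + 2 * al) * conv_binc al x N.
Proof.
pose proof (conv_weight_add al x (S (S N))) as H2.
pose proof (conv_weight_add al x (S N)) as H1.
pose proof (conv_weight_add al x N) as H0.
rewrite <- H2, (conv_weight_fst_S _ _ (S N)), (conv_weight_snd_S _ _ (S N)).
rewrite (Rmult_plus_distr_l (1 - x)), (Rmult_plus_distr_r _ _ (conv_binc al x (S N))).
rewrite (Rmult_assoc (1 - x) (INR (S N))), <- H1.
rewrite (Rmult_plus_distr_l x), (Rmult_plus_distr_r _ _ (conv_binc al x N)).
rewrite (Rmult_assoc x (INR N)), <- H0.
rewrite (conv_weight_fst_S _ _ N), (conv_weight_snd_S _ _ N); ring.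
Qed.

(** The defining sum alternates in sign, but the two coefficients of the recurrence [conv_binc_SS]
    are nonnegative for [0 <= x <= 1]. *)
Lemma conv_binc_ge_0 (al x : R) (N : nat) :
  0 < al -> 0 <= x <= 1 -> 0 <= conv_binc al x N.
Proof.
intros Hal Hx.
assert (H : 0 <= conv_binc al x N /\ 0 <= conv_binc al x (S N)); [|apply H].
induction N as [|N [IH0 IH1]].
- rewrite conv_binc_0, conv_binc_1; split; nra.
- split; [exact IH1|].
  apply Rmult_le_reg_l with (INR (S (S N))); [apply lt_0_INR; lia|].
  rewrite Rmult_0_r, conv_binc_SS.
  pose proof (pos_INR N); pose proof (pos_INR (S N)).
  apply Rplus_le_le_0_compat; apply Rmult_le_pos; auto; apply Rmult_le_pos; lra.
Qed.

(** At [x = 1] the middle term of the recurrence drops out, so even and odd indices separate: the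
    generating function is [(1 - t^2)^-al]. *)
Lemma conv_binc_at_1 (al : R) (n : nat) :
  conv_binc al 1 (2 * n) = binc al n /\ conv_binc al 1 (S (2 * n)) = 0.
Proof.
induction n as [|n [IH0 IH1]].
- simpl Nat.mul; rewrite conv_binc_0, conv_binc_1; unfold binc; simpl; split; field.
- replace (2 * S n)%nat with (S (S (2 * n))) by lia.
  pose proof (conv_binc_SS al 1 (2 * n)) as H0.
  pose proof (conv_binc_SS al 1 (S (2 * n))) as H1.
  pose proof (binc_S al n) as Hp.
  rewrite IH0, IH1 in H0; rewrite IH1 in H1.
  pose proof (pos_INR n) as Hn.
  split.
  + apply Rmult_eq_reg_l with (2 * INR (S n)).
    2:{ rewrite S_INR; lra. }
    rewrite (Rmult_assoc 2 (INR (S n)) (binc al (S n))), Hp.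
    replace (2 * INR (S n)) with (INR (S (S (2 * n)))).
    2:{ rewrite !S_INR, mult_INR; simpl; ring. }
    rewrite H0, mult_INR; simpl; ring.
  + apply Rmult_eq_reg_l with (INR (S (S (S (2 * n))))).
    2:{ apply not_0_INR; lia. }
    rewrite H1; ring.
Qed.

(** Both sides run over the triangle [n + k <= M], on the left by diagonals [n + k = N], on the
    right by rows. *)
Lemma sum_n_triangle (al x : R) (w : nat -> R) (M : nat) :
  sum_n (fun N => w N * conv_binc al x N) M =
  sum_n (fun n => (- x) ^ n * binc al n *
                  sum_n (fun k => binc al k * w (n + k)%nat) (M - n)) M.
Proof.
induction M as [|M IH].
- rewrite !sum_O, conv_binc_0.
  unfold binc; simpl; field.
- rewrite sum_Sn, IH, (sum_Sn _ M), Nat.sub_diag, sum_O, Nat.add_0_r.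
  rewrite (sum_n_ext_R
    (fun n => (- x) ^ n * binc al n * sum_n (fun k => binc al k * w (n + k)%nat) (S M - n))
    (fun n => (- x) ^ n * binc al n * sum_n (fun k => binc al k * w (n + k)%nat) (M - n) +
              w (S M) * (1 * ((- x) ^ n * (binc al n * binc al (S M - n)))))).
  + rewrite sum_n_plus_R, sum_n_scal_R; unfold conv_binc, conv_weight.
    rewrite sum_Sn, Nat.sub_diag; unfold plus; simpl; ring.
  + intros n Hn; rewrite (Nat.sub_succ_l n M) by lia.
    rewrite sum_Sn; unfold plus; simpl AbelianMonoid.plus.
    replace (n + S (M - n))%nat with (S M) by lia.
    unfold AbelianMonoid.plus; simpl; ring.
Qed.

Lemma conv_binc_is_lim_seq (al : R) (N : nat) (x : nat -> R) (l : R) :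
  is_lim_seq x l -> is_lim_seq (fun j => conv_binc al (x j) N) (conv_binc al l N).
Proof.
intros Hx; unfold conv_binc, conv_weight.
apply (is_lim_seq_sum_n
  (fun n j => 1 * ((- x j) ^ n * (binc al n * binc al (N - n))))); intros n.
apply is_lim_seq_mult'; [apply is_lim_seq_const|].
apply is_lim_seq_mult'; [|apply is_lim_seq_const].
induction n as [|n IH]; [apply is_lim_seq_const|].
apply is_lim_seq_mult'; [|exact IH].
apply (is_lim_seq_opp _ l), Hx.
Qed.

(** The left side increases with [M], and the right side is its limit: in the triangle each row
    tends to [shifted_gauss al be c n]. The rows are dominated by the terms of the series at [+x],
    whose convergence is therefore assumed. *)
Lemma sum_conv_le (al be c x : R) (M : nat) :
  0 < al -> 0 < be -> al + be < c -> 0 <= x <= 1 ->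
  ex_series (fun n => binc al n * bmom be (c - al) n * x ^ n) ->
  sum_n (fun N => bmom be c N * conv_binc al x N) M <=
  gauss_sum al be c * Series (fun n => binc al n * bmom be (c - al) n * (- x) ^ n).
Proof.
intros Hal Hbe Hc Hx Hex.
set (T := gauss_sum al be c).
set (a := fun n k => binc al k * bmom be c (n + k)).
assert (Ha : forall n k, 0 < a n k).
{ intros; apply Rmult_lt_0_compat; [now apply binc_pos|apply bmom_pos; lra]. }
pose proof (fun n => ex_series_shifted_gauss al be c n Hal Hbe Hc) as HS.
assert (Hlim : is_lim_seq (sum_n (fun N => bmom be c N * conv_binc al x N))
  (Series (fun n => (- x) ^ n * binc al n * shifted_gauss al be c n))).
{ apply is_lim_seq_ext with
    (fun M => sum_n (fun n => (- x) ^ n * binc al n * sum_n (a n) (M - n)) M).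
  { intros; symmetry; apply sum_n_triangle. }
  apply (is_lim_seq_tannery (fun n M => (- x) ^ n * binc al n * sum_n (a n) (M - n)) _
    (fun n => T * (binc al n * bmom be (c - al) n * x ^ n))).
  - intros n N HN.
    assert (H0 : 0 < binc al n) by now apply binc_pos.
    rewrite !Rabs_mult, <- RPow_abs, Rabs_Ropp, !(Rabs_pos_eq x) by lra.
    rewrite (Rabs_pos_eq (binc al n)) by lra.
    assert (H1 : sum_n (a n) (N - n) <= T * bmom be (c - al) n).
    { unfold T, gauss_sum; rewrite <- shifted_gauss_eq by lra.
      apply is_series_ge_sum_n; [|apply HS]; intros; now apply Rlt_le. }
    assert (H2 : 0 <= sum_n (a n) (N - n)).
    { replace 0 with (sum_n (fun _ => 0) (N - n)) by (rewrite sum_n_const; real_eq; ring).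
      apply sum_n_m_le; intros; now apply Rlt_le. }
    rewrite (Rabs_pos_eq (sum_n _ _)) by exact H2.
    replace (T * (binc al n * bmom be (c - al) n * x ^ n))
      with (x ^ n * binc al n * (T * bmom be (c - al) n)) by ring.
    apply Rmult_le_compat_l; [|exact H1].
    apply Rmult_le_pos; [apply pow_le; lra|lra].
  - apply (ex_series_scal_l (V := R_NormedModule) T
      (fun n => binc al n * bmom be (c - al) n * x ^ n)), Hex.
  - intros n; apply is_lim_seq_mult'; [apply is_lim_seq_const|].
    apply (is_lim_seq_incr_n _ n).
    apply is_lim_seq_ext with (sum_n (a n)).
    { intros k; now replace (k + n - n)%nat with k by lia. }
    apply HS. }
replace (T * Series _)
  with (Series (fun n => (- x) ^ n * binc al n * shifted_gauss al be c n)).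
- apply (is_lim_seq_incr_compare (sum_n (fun N => bmom be c N * conv_binc al x N))
    _ Hlim).
  intros N; rewrite sum_Sn; unfold plus; simpl.
  pose proof (bmom_pos be c (S N) Hbe ltac:(lra)).
  pose proof (conv_binc_ge_0 al x (S N) Hal Hx); nra.
- rewrite <- Series_scal_l; apply Series_ext; intros n.
  rewrite shifted_gauss_eq by lra; unfold T, gauss_sum; ring.
Qed.

Lemma sum_even_conv (al be c : R) (M : nat) :
  sum_n (fun N => bmom be c N * conv_binc al 1 N) (2 * M) =
  sum_n (fun n => binc al n * bmom be c (2 * n)) M.
Proof.
induction M as [|M IH].
- simpl Nat.mul; rewrite !sum_O, conv_binc_0; unfold binc, bmom; simpl; field.
- replace (2 * S M)%nat with (S (S (2 * M))) by lia.
  rewrite !sum_Sn, IH.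
  replace (S (S (2 * M))) with (2 * S M)%nat by lia.
  rewrite (proj1 (conv_binc_at_1 al (S M))), (proj2 (conv_binc_at_1 al M)).
  unfold plus; simpl; ring.
Qed.

(* [g] is the restriction to the real line of the Gauss function with
   parameters [al], [be], [c - al]. *)
Lemma sum_le_gauss_Gamma (al be c : R) (g : R -> R) (g1 : R) (M : nat) :
  0 < al -> 0 < be -> al + be < c ->
  (forall x, -1 < x < 1 ->
     is_series (fun n => binc al n * bmom be (c - al) n * x ^ n) (g x)) ->
  filterlim g (at_right (-1)) (locally g1) ->
  sum_n (fun n => binc al n * bmom be c (2 * n)) M <= gauss_Gamma al be c * g1.
Proof.
intros Hal Hbe Hc Hg Hg1.
set (x := fun j => 1 - / (INR j + 1)).
assert (Hx : forall j, 0 <= x j < 1).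
{ intros j; pose proof (pos_INR j); unfold x.
  assert (0 < / (INR j + 1)) by (apply Rinv_0_lt_compat; lra).
  assert (/ (INR j + 1) <= 1) by (rewrite <- Rinv_1; apply Rinv_le_contravar; lra).
  lra. }
assert (Hxlim : is_lim_seq x 1).
{ pose proof (is_lim_seq_minus' (fun _ => 1) (fun j => / (INR j + 1)) 1 0) as H.
  rewrite Rminus_0_r in H; apply H; [apply is_lim_seq_const|].
  apply (is_lim_seq_inv _ p_infty); [|discriminate].
  apply (is_lim_seq_plus _ _ p_infty 1 p_infty);
    [apply is_lim_seq_INR|apply is_lim_seq_const|reflexivity]. }
assert (HT : 0 < gauss_sum al be c) by now apply shifted_gauss_pos.
assert (Hlim : forall N,
  sum_n (fun N => bmom be c N * conv_binc al 1 N) N <= gauss_sum al be c * g1).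
{ intros N.
  apply (is_lim_seq_le
    (fun j => sum_n (fun N => bmom be c N * conv_binc al (x j) N) N)
    (fun j => gauss_sum al be c * g (- x j))
    (sum_n (fun N => bmom be c N * conv_binc al 1 N) N) (gauss_sum al be c * g1)).
  - intros j; specialize (Hx j).
    rewrite <- (is_series_unique _ _ (Hg (- x j) ltac:(lra))).
    apply sum_conv_le; auto; [lra|].
    eexists; apply Hg; lra.
  - apply (is_lim_seq_sum_n (fun N j => bmom be c N * conv_binc al (x j) N)).
    intros n; apply is_lim_seq_mult'; [apply is_lim_seq_const|].
    now apply conv_binc_is_lim_seq.
  - apply is_lim_seq_mult'; [apply is_lim_seq_const|].
    apply filterlim_comp with (2 := Hg1).
    intros P [eps HP].
    apply is_lim_seq_spec in Hxlim; destruct (Hxlim eps) as [j0 Hj0].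
    exists j0; intros j Hj; specialize (Hj0 j Hj); specialize (Hx j).
    apply HP; [|lra].
    apply Rabs_lt_between' in Hj0; apply Rabs_lt_between'; lra. }
rewrite <- sum_even_conv.
apply Rle_trans with (gauss_sum al be c * g1); [apply Hlim|].
apply Rmult_le_compat_r; [|now apply gauss_sum_le_Gamma].
(* The case [N = 0] says [1 <= gauss_sum al be c * g1], hence [0 <= g1], which is what replacing
   [gauss_sum] by the larger [gauss_Gamma] requires. *)
specialize (Hlim 0%nat); rewrite sum_O, conv_binc_0 in Hlim.
unfold bmom in Hlim; simpl in Hlim.
apply Rmult_le_reg_l with (gauss_sum al be c); [exact HT|lra].
Qed.

(** * Complex power series, their derivatives, and the coefficient criterion *)

Lemma Re_sum_n (u : nat -> C) (n : nat) :
  Re (sum_n u n) = sum_n (fun k => Re (u k)) n.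
Proof.
induction n as [|n IH]; [now rewrite !sum_O|].
now rewrite !sum_Sn, <- IH.
Qed.

Lemma Im_sum_n (u : nat -> C) (n : nat) :
  Im (sum_n u n) = sum_n (fun k => Im (u k)) n.
Proof.
induction n as [|n IH]; [now rewrite !sum_O|].
now rewrite !sum_Sn, <- IH.
Qed.

Lemma is_series_Re (u : nat -> C) (l : C) :
  is_series u l -> is_series (fun n => Re (u n)) (Re l).
Proof.
intros H.
apply filterlim_ext with (fun n => Re (sum_n u n)).
{ intros; apply Re_sum_n. }
apply filterlim_comp with (1 := H).
destruct l as [x y]; apply (continuous_fst (U := R_UniformSpace) (V := R_UniformSpace)).
Qed.

Lemma is_series_Im (u : nat -> C) (l : C) :
  is_series u l -> is_series (fun n => Im (u n)) (Im l).
Proof.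
intros H.
apply filterlim_ext with (fun n => Im (sum_n u n)).
{ intros; apply Im_sum_n. }
apply filterlim_comp with (1 := H).
destruct l as [x y]; apply (continuous_snd (U := R_UniformSpace) (V := R_UniformSpace)).
Qed.

Lemma is_series_C_unique (u : nat -> C) (l : C) :
  is_series u l -> l = (Series (fun n => Re (u n)), Series (fun n => Im (u n))).
Proof.
intros H; rewrite (is_series_unique _ _ (is_series_Re _ _ H)).
rewrite (is_series_unique _ _ (is_series_Im _ _ H)); now destruct l.
Qed.

Lemma is_series_Cmod_le (u : nat -> C) (b : nat -> R) (l : C) (B : R) :
  is_series u l -> is_series b B -> (forall n, Cmod (u n) <= b n) -> Cmod l <= B.
Proof.
intros Hu Hb Hle.
apply (is_lim_seq_le (fun n => Cmod (sum_n u n)) (sum_n b) (Cmod l) B).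
- intros n; apply Rle_trans with (sum_n (fun k => Cmod (u k)) n).
  + apply (norm_sum_n_m (K := C_AbsRing) (V := C_NormedModule)).
  + now apply sum_n_m_le.
- apply filterlim_comp with (1 := Hu).
  apply (filterlim_norm (K := C_AbsRing) (V := C_NormedModule)).
- exact Hb.
Qed.

Lemma is_pseries_C (u : nat -> C) (z l : C) :
  is_pseries u z l <-> is_series (fun n => (u n * z ^ n)%C) l.
Proof.
assert (Heq : forall n, scal (pow_n z n) (u n) = (u n * z ^ n)%C).
{ intros n; apply Cmult_comm. }
split; apply is_series_ext; intros n; [|symmetry]; apply Heq.
Qed.

Lemma C_PSeries_correct (u : nat -> C) (z : C) :
  ex_series (fun n => Cmod (u n)) -> Cmod z <= 1 -> is_pseries u z (C_PSeries u z).
Proof.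
intros Hu Hz.
assert (Hex : ex_series (fun n => (u n * z ^ n)%C)).
{ apply (ex_series_le (K := C_AbsRing) (V := C_CompleteNormedModule)
    (fun n => (u n * z ^ n)%C) (fun n => Cmod (u n))); [|exact Hu].
  intros n; change (Cmod (u n * z ^ n) <= Cmod (u n)).
  rewrite Cmod_mult, Cmod_pow; rewrite <- (Rmult_1_r (Cmod (u n))) at 2.
  apply Rmult_le_compat_l; [apply Cmod_ge_0|].
  rewrite <- (pow1 n); apply pow_incr; split; [apply Cmod_ge_0|exact Hz]. }
destruct Hex as [l Hl].
unfold C_PSeries; rewrite <- (is_series_C_unique _ _ Hl).
now apply is_pseries_C.
Qed.

(** The bound has to be linear in [n], since [sum n b_n] is the convergent series at hand. Keeping
    [w] in a smaller disk achieves this: passing to [n + 1] multiplies the remainder by [w] and adds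
    [n z^(n-1) (w - z)^2], and [rho * n / (1 - rho) + n = n / (1 - rho)]. *)
Lemma Cpow_second_difference (z w : C) (rho : R) (n : nat) :
  rho < 1 -> Cmod z <= 1 -> Cmod w <= rho ->
  Cmod (w ^ n - z ^ n - INR n * z ^ pred n * (w - z)) <=
  INR n / (1 - rho) * Cmod (w - z) ^ 2.
Proof.
intros Hrho Hz Hw; induction n as [|n IH].
- replace (w ^ 0 - z ^ 0 - INR 0 * z ^ pred 0 * (w - z))%C with (RtoC 0) by (simpl; ring).
  rewrite Cmod_0; simpl; lra.
- assert (Hpred : (INR n * z ^ pred n * z = INR n * z ^ n)%C).
  { destruct n as [|n]; [simpl; ring|]; rewrite Cpow_S; simpl pred; ring. }
  replace (w ^ S n - z ^ S n - INR (S n) * z ^ pred (S n) * (w - z))%C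
    with (w * (w ^ n - z ^ n - INR n * z ^ pred n * (w - z)) +
          INR n * z ^ pred n * ((w - z) * (w - z)))%C.
  2:{ rewrite !Cpow_S, S_INR, RtoC_plus; simpl pred.
      transitivity (w * w ^ n - w * z ^ n - (INR n * z ^ pred n * z) * (w - z))%C; [ring|].
      rewrite Hpred; ring. }
  eapply Rle_trans; [apply Cmod_triangle|].
  rewrite !Cmod_mult, Cmod_pow, Cmod_R, (Rabs_pos_eq (INR n)) by apply pos_INR.
  pose proof (Cmod_ge_0 w) as Hw0; pose proof (Cmod_ge_0 z) as Hz0.
  pose proof (pos_INR n) as Hn.
  set (D := Cmod (w - z)) in *.
  assert (HD : 0 <= D) by apply Cmod_ge_0.
  assert (Hz1 : Cmod z ^ pred n <= 1).
  { rewrite <- (pow1 (pred n)); apply pow_incr; lra. }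
  assert (Hz2 : 0 <= Cmod z ^ pred n) by (apply pow_le; lra).
  assert (H1 : Cmod w * Cmod (w ^ n - z ^ n - INR n * z ^ pred n * (w - z)) <=
               rho * (INR n / (1 - rho) * D ^ 2)).
  { apply Rmult_le_compat; auto; apply Cmod_ge_0. }
  assert (H2 : INR n * Cmod z ^ pred n * (D * D) <= INR n * (D ^ 2)).
  { simpl; rewrite Rmult_1_r; apply Rmult_le_compat_r; nra. }
  apply Rle_trans with (rho * (INR n / (1 - rho) * D ^ 2) + INR n * D ^ 2); [lra|].
  rewrite S_INR.
  replace (rho * (INR n / (1 - rho) * D ^ 2) + INR n * D ^ 2)
    with (INR n / (1 - rho) * D ^ 2) by (field; lra).
  apply Rmult_le_compat_r; [nra|].
  apply Rmult_le_compat_r; [|lra].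
  apply Rlt_le, Rinv_0_lt_compat; lra.
Qed.

Lemma C_PSeries_second_order (u : nat -> C) (b : nat -> R) (P rho : R) (z w h : C) :
  ex_series (fun n => Cmod (u n)) ->
  (forall n, Cmod (u n) <= b n) -> is_series (fun n => INR n * b n) P ->
  rho < 1 -> Cmod z <= 1 -> Cmod w <= rho ->
  is_series (fun n => (u n * (INR n * z ^ pred n))%C) h ->
  Cmod (C_PSeries u w - C_PSeries u z - h * (w - z)) <= P / (1 - rho) * Cmod (w - z) ^ 2.
Proof.
intros Hu Hb HP Hrho Hz Hw Hh.
pose proof (proj1 (is_pseries_C _ _ _) (C_PSeries_correct u z Hu Hz)) as Sz.
pose proof (proj1 (is_pseries_C _ _ _) (C_PSeries_correct u w Hu ltac:(lra))) as Sw.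
pose proof (is_series_minus _ _ _ _ (is_series_minus _ _ _ _ Sw Sz)
  (is_series_scal (w - z)%C _ _ Hh)) as HS.
rewrite (Cmult_comm h).
apply is_series_Cmod_le with (1 := HS)
  (b := fun n => / (1 - rho) * Cmod (w - z) ^ 2 * (INR n * b n)).
- replace (P / (1 - rho) * Cmod (w - z) ^ 2)
    with (/ (1 - rho) * Cmod (w - z) ^ 2 * P) by (field; lra).
  apply (is_series_scal_l (V := R_NormedModule) (/ (1 - rho) * Cmod (w - z) ^ 2)
    (fun n => INR n * b n)), HP.
- intros n.
  change (Cmod (u n * w ^ n - u n * z ^ n - (w - z) * (u n * (INR n * z ^ pred n))) <=
    / (1 - rho) * Cmod (w - z) ^ 2 * (INR n * b n)).
  replace (u n * w ^ n - u n * z ^ n - (w - z) * (u n * (INR n * z ^ pred n)))%C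
    with (u n * (w ^ n - z ^ n - INR n * z ^ pred n * (w - z)))%C by ring.
  rewrite Cmod_mult.
  replace (/ (1 - rho) * Cmod (w - z) ^ 2 * (INR n * b n))
    with (b n * (INR n / (1 - rho) * Cmod (w - z) ^ 2)) by (field; lra).
  apply Rmult_le_compat; auto using Cmod_ge_0.
  now apply Cpow_second_difference.
Qed.

Lemma C_derive_second_order (f : C -> C) (z l : C) (rho K : R) :
  Cmod z < rho ->
  (forall w, Cmod w <= rho -> Cmod (f w - f z - l * (w - z)) <= K * Cmod (w - z) ^ 2) ->
  C_derive f z = l.
Proof.
intros Hz HK; apply is_C_derive_unique; split.
- apply is_linear_scal_l.
- intros x Hx; apply (is_filter_lim_locally_unique (K := C_AbsRing)
    (V := AbsRing_NormedModule C_AbsRing)) in Hx; subst x; intros eps.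
  assert (HK' : 0 < Rabs K + 1) by (pose proof (Rabs_pos K); lra).
  assert (Hd : 0 < Rmin (rho - Cmod z) (eps / (Rabs K + 1))).
  { apply Rmin_glb_lt; [lra|]; apply Rdiv_lt_0_compat; [apply cond_pos|exact HK']. }
  apply (locally_le_locally_norm (K := C_AbsRing) (V := AbsRing_NormedModule C_AbsRing)).
  exists (mkposreal _ Hd); intros w Hw.
  change (Cmod (w - z) < Rmin (rho - Cmod z) (eps / (Rabs K + 1))) in Hw.
  pose proof (Rmin_l (rho - Cmod z) (eps / (Rabs K + 1))).
  pose proof (Rmin_r (rho - Cmod z) (eps / (Rabs K + 1))).
  change (Cmod (f w - f z - (w - z) * l) <= eps * Cmod (w - z)).
  rewrite (Cmult_comm (w - z)).
  eapply Rle_trans; [apply HK|].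
  + replace w with (z + (w - z))%C by ring.
    eapply Rle_trans; [apply Cmod_triangle|lra].
  + pose proof (Cmod_ge_0 (w - z)) as Hwz.
    replace (K * Cmod (w - z) ^ 2) with (K * Cmod (w - z) * Cmod (w - z)) by ring.
    apply Rmult_le_compat_r; [exact Hwz|].
    apply Rle_trans with ((Rabs K + 1) * Cmod (w - z)).
    * apply Rmult_le_compat_r; [exact Hwz|]; pose proof (Rle_abs K); lra.
    * apply Rle_trans with ((Rabs K + 1) * (eps / (Rabs K + 1))).
      -- apply Rmult_le_compat_l; lra.
      -- right; field; lra.
Qed.

(** For [f = z H] the quantity to bound is [z H' / H]. With [r = |z|], [P = sum n b_n] and [Q] the
    sum of [b_n] over [n >= 1], one has [|z H'| <= r P] and [|H| >= 1 - r Q]. The assumption reads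
    [P <= lam (1 - Q)], so [r P <= lam (r - r Q) < lam (1 - r Q)]. *)
Lemma class_Sstar_of_coef (lam : R) (u : nat -> C) (b : nat -> R) :
  0 < lam -> u 0%nat = RtoC 1 -> b 0%nat = 1 -> 0 < b 1%nat ->
  (forall n, Cmod (u n) <= b n) ->
  (forall n, sum_n (fun k => (INR k + lam) * b k) n <= 2 * lam) ->
  class_Sstar lam (fun z => (z * C_PSeries u z)%C).
Proof.
intros Hlam Hu0 Hb0 Hb1 Hub Hsum.
assert (Hb : forall n, 0 <= b n).
{ intros n; apply Rle_trans with (2 := Hub n), Cmod_ge_0. }
assert (Hex : ex_series (fun k => (INR k + lam) * b k)).
{ apply ex_series_bounded with (2 * lam); auto.
  intros n; apply Rmult_le_pos; auto; pose proof (pos_INR n); lra. }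
assert (Hexb : ex_series b).
{ apply (ex_series_ext (fun k => scal (/ lam) (lam * b k))).
  { intros n; unfold scal; simpl; unfold mult; simpl; real_eq; field; lra. }
  apply (ex_series_scal_l (V := R_NormedModule)).
  apply (ex_series_le (K := R_AbsRing) (V := R_CompleteNormedModule) _ _) with (2 := Hex).
  intros n; pose proof (pos_INR n); specialize (Hb n).
  change (Rabs (lam * b n) <= (INR n + lam) * b n).
  rewrite Rabs_pos_eq; nra. }
assert (Hexn : exists P : R, is_series (fun n => INR n * b n) P).
{ apply (ex_series_le (K := R_AbsRing) (V := R_CompleteNormedModule)
    (fun n => INR n * b n) _) with (2 := Hex).
  intros n; pose proof (pos_INR n); specialize (Hb n).
  change (Rabs (INR n * b n) <= (INR n + lam) * b n).
  rewrite Rabs_pos_eq; nra. }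
assert (Hexu : ex_series (fun n => Cmod (u n))).
{ apply (ex_series_le (K := R_AbsRing) (V := R_CompleteNormedModule) _ _) with (2 := Hexb).
  intros n; change (Rabs (Cmod (u n)) <= b n).
  rewrite Rabs_pos_eq; [apply Hub|apply Cmod_ge_0]. }
destruct Hexn as [P HP].
assert (Hexb1 : exists Q : R, is_series (fun n => b (S n)) Q) by now apply (ex_series_incr_1 b).
destruct Hexb1 as [Q HQ].
assert (HbQ : is_series b (1 + Q)).
{ apply is_series_decr_1; rewrite Hb0.
  assert (E : Q = 1 + Q + - 1) by ring.
  rewrite E in HQ; exact HQ. }
assert (HPQ : P + lam * (1 + Q) <= 2 * lam).
{ pose proof (is_series_plus _ _ _ _ HP (is_series_scal_l lam _ _ HbQ)) as H.
  apply (is_lim_seq_le (sum_n (fun k => (INR k + lam) * b k)) (fun _ => 2 * lam)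
    (P + lam * (1 + Q)) (2 * lam)); auto.
  - apply is_lim_seq_ext with (2 := H); intros n; apply sum_n_ext; intros k.
    unfold plus, scal; simpl; unfold mult; simpl; real_eq; ring.
  - apply is_lim_seq_const. }
assert (HP1 : b 1%nat <= P).
{ apply Rle_trans with (sum_n (fun n => INR n * b n) 1).
  - rewrite sum_Sn, sum_O; unfold plus; simpl; lra.
  - apply is_series_ge_sum_n; auto.
    intros; apply Rmult_le_pos; auto; apply pos_INR. }
assert (HQ1 : b 1%nat <= Q).
{ apply Rle_trans with (sum_n (fun n => b (S n)) 0).
  - rewrite sum_O; lra.
  - apply is_series_ge_sum_n; auto. }
split.
- exists (fun n => match n with O => RtoC 0 | S k => u k end).
  split; [reflexivity|split; [exact Hu0|]].
  intros z Hz; apply is_pseries_C, is_series_decr_1.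
  pose proof (proj1 (is_pseries_C _ _ _)
    (C_PSeries_correct u z Hexu (Rlt_le _ _ Hz))) as H.
  apply (is_series_scal z) in H.
  replace (plus _ _) with (scal z (C_PSeries u z)).
  + apply is_series_ext with (2 := H); intros n.
    change ((z * (u n * z ^ n))%C = (u n * z ^ S n)%C); rewrite Cpow_S; ring.
  + change ((z * C_PSeries u z)%C = (z * C_PSeries u z - 0 * z ^ 0)%C); ring.
- intros z Hz Hz0; unfold in_disk in Hz.
  set (r := Cmod z) in *.
  assert (Hr : 0 < r) by now apply Cmod_gt_0.
  set (H := C_PSeries u z).
  assert (HH : Cmod (H - 1) <= r * Q).
  { pose proof (proj1 (is_pseries_C _ _ _)
      (C_PSeries_correct u z Hexu (Rlt_le _ _ Hz))) as HS; fold H in HS.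
    assert (E : H = (H - 1 + u 0%nat * z ^ 0)%C) by (rewrite Hu0; simpl; ring).
    rewrite E in HS; apply (is_series_incr_1 (fun n => (u n * z ^ n)%C)) in HS.
    apply is_series_Cmod_le with (1 := HS) (2 := is_series_scal_l r _ _ HQ).
    - intros n; rewrite Cmod_mult, Cmod_pow; fold r.
      change (Cmod (u (S n)) * r ^ S n <= r * b (S n)).
      rewrite (Rmult_comm r); apply Rmult_le_compat; auto using Cmod_ge_0.
      + apply pow_le; lra.
      + rewrite <- tech_pow_Rmult.
        assert (r ^ n <= 1) by (rewrite <- (pow1 n); apply pow_incr; lra).
        nra. }
  assert (HQ0 : Q < 1) by nra.
  assert (HHlow : 1 - r * Q <= Cmod H).
  { pose proof (Cmod_triangle (1 - H) H) as Ht.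
    replace (1 - H + H)%C with (RtoC 1) in Ht by ring.
    replace (1 - H)%C with (- (H - 1))%C in Ht by ring.
    rewrite Cmod_opp, Cmod_1 in Ht; lra. }
  assert (HrQ : 0 < 1 - r * Q) by nra.
  assert (HnzH : H <> 0).
  { intros E; rewrite E, Cmod_0 in HHlow; lra. }
  assert (Hder : forall n, Cmod (u n * (INR n * z ^ pred n)) <= INR n * b n).
  { intros n; rewrite !Cmod_mult, Cmod_pow, Cmod_R; fold r.
    rewrite Rabs_pos_eq by apply pos_INR.
    rewrite Rmult_comm, (Rmult_comm _ (r ^ pred n)), Rmult_assoc.
    rewrite <- (Rmult_1_l (INR n * b n)).
    apply Rmult_le_compat.
    - apply pow_le; lra.
    - apply Rmult_le_pos; [apply pos_INR|apply Cmod_ge_0].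
    - rewrite <- (pow1 (pred n)); apply pow_incr; lra.
    - apply Rmult_le_compat_l; [apply pos_INR|apply Hub]. }
  assert (Hex' : ex_series (fun n => (u n * (INR n * z ^ pred n))%C)).
  { apply (ex_series_le (K := C_AbsRing) (V := C_CompleteNormedModule) _
      (fun n => INR n * b n)); [exact Hder|eexists; exact HP]. }
  destruct Hex' as [h Hh].
  assert (Hhle : Cmod h <= P) by (apply is_series_Cmod_le with (1 := Hh) (2 := HP); auto).
  assert (HC : C_derive (fun w => w * C_PSeries u w)%C z = (H + z * h)%C).
  (* A radius strictly between [r] and 1 leaves room around [z] and keeps [1 - rho] positive. *)
  { set (rho := (1 + r) / 2).
    apply C_derive_second_order with (rho := rho) (K := P / (1 - rho) + P).
    - fold r; unfold rho; lra.
    - intros w Hw; fold H.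
      assert (Hrho : 0 <= rho < 1) by (unfold rho; lra).
      replace (w * C_PSeries u w - z * H - (H + z * h) * (w - z))%C
        with (w * (C_PSeries u w - H - h * (w - z)) + h * ((w - z) * (w - z)))%C by ring.
      eapply Rle_trans; [apply Cmod_triangle|].
      rewrite !Cmod_mult, Rmult_plus_distr_r.
      pose proof (C_PSeries_second_order u b P rho z w h Hexu Hub HP
        (proj2 Hrho) (Rlt_le _ _ Hz) Hw Hh) as H2; fold H in H2.
      pose proof (Cmod_ge_0 (w - z)).
      pose proof (Cmod_ge_0 (C_PSeries u w - H - h * (w - z))).
      pose proof (Cmod_ge_0 w).
      apply Rplus_le_compat.
      + eapply Rle_trans; [|exact H2].
        rewrite <- (Rmult_1_l (Cmod (C_PSeries u w - H - h * (w - z)))) at 2.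
        apply Rmult_le_compat_r; lra.
      + apply Rle_trans with (P * (Cmod (w - z) * Cmod (w - z))).
        * apply Rmult_le_compat_r; [nra|exact Hhle].
        * right; ring. }
  split.
  + fold H; now apply Cmult_neq_0.
  + rewrite HC; fold H.
    replace (z * (H + z * h) / (z * H) - 1)%C with (z * h / H)%C.
    2:{ field; split; assumption. }
    rewrite Cmod_div, Cmod_mult by assumption; fold r.
    apply Rlt_div_l; [lra|].
    apply Rle_lt_trans with (r * P).
    * apply Rmult_le_compat_l; lra.
    * apply Rlt_le_trans with (lam * (1 - r * Q)); [nra|].
      apply Rmult_le_compat_l; lra.
Qed.

(** * From the complex Gauss function to real series and continuity at -1 *)

Lemma poch_RtoC (x : R) (n : nat) : poch (RtoC x) n = RtoC (rpoch x n).
Proof.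
induction n as [|n IH]; [reflexivity|].
simpl; rewrite IH, RtoC_mult, RtoC_plus; reflexivity.
Qed.

Lemma poch_RtoC_neq_0 (x : R) (n : nat) : 0 < x -> poch (RtoC x) n <> RtoC 0.
Proof.
intros Hx E; rewrite poch_RtoC in E; apply RtoC_inj in E.
pose proof (rpoch_pos x n Hx); lra.
Qed.

Lemma coef2F1_RtoC (al be c : R) (n : nat) : 0 < c ->
  coef2F1 al be c n = RtoC (binc al n * bmom be c n).
Proof.
intros Hc; unfold coef2F1; rewrite !poch_RtoC.
pose proof (rpoch_pos c n Hc); pose proof (rpoch_pos 1 n Rlt_0_1).
rewrite <- !RtoC_mult, <- RtoC_div by nra.
f_equal; unfold binc, bmom; field; lra.
Qed.

Lemma is_hyp2F1_real_series (al be c : R) (G : C -> C) (x : R) :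
  0 < c -> is_hyp2F1 al be c G -> -1 < x < 1 ->
  is_series (fun n => binc al n * bmom be c n * x ^ n) (Re (G (RtoC x))).
Proof.
intros Hc [_ HG] Hx.
assert (Hd : in_disk (RtoC x)) by (unfold in_disk; rewrite Cmod_R; now apply Rabs_def1).
specialize (HG _ Hd); apply is_pseries_C, is_series_Re in HG.
apply is_series_ext with (2 := HG); intros n.
now rewrite coef2F1_RtoC, <- RtoC_pow, <- RtoC_mult by exact Hc.
Qed.

(** Along the real line, [Re G] is the real power series with coefficients [Re (u n)], and real
    power series are continuous inside their disk of convergence. *)
Lemma analytic_at_continuous_right (G : C -> C) (x : R) :
  analytic_at G (RtoC x) ->
  filterlim (fun t => Re (G (RtoC t))) (at_right x) (locally (Re (G (RtoC x)))).
Proof.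
intros (u & r & Hr & Hu).
set (a := fun n => Re (u n)).
assert (Ha : forall s, Rabs s < r -> is_series (fun n => a n * s ^ n) (Re (G (RtoC (x + s))))).
{ intros s Hs.
  assert (E : (RtoC (x + s) - RtoC x = RtoC s)%C) by (rewrite RtoC_plus; ring).
  specialize (Hu (RtoC (x + s))); rewrite E, Cmod_R in Hu; specialize (Hu Hs).
  apply is_pseries_C, is_series_Re in Hu.
  apply is_series_ext with (2 := Hu); intros n.
  rewrite <- RtoC_pow; unfold a, Re; simpl; ring. }
assert (HPS : forall s, Rabs s < r -> Re (G (RtoC (x + s))) = PSeries a s).
{ intros s Hs; symmetry; apply is_series_unique, Ha, Hs. }
(* With radius 0 the terms at [r / 2] could not tend to 0, yet the series converges there. *)
assert (Hcv : Rbar_lt (Rabs 0) (CV_radius a)).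
{ apply Rbar_not_le_lt; intros Hle.
  apply (CV_disk_outside a (r / 2)).
  - apply Rbar_le_lt_trans with (1 := Hle); simpl.
    rewrite Rabs_R0, Rabs_pos_eq; lra.
  - apply ex_series_lim_0; eexists; apply Ha; rewrite Rabs_pos_eq; lra. }
apply PSeries_continuity, continuity_pt_filterlim in Hcv.
replace (Re (G (RtoC x))) with (PSeries a 0).
2:{ rewrite <- HPS by (rewrite Rabs_R0; exact Hr); now rewrite Rplus_0_r. }
apply filterlim_ext_loc with (fun t => PSeries a (t - x)).
- exists (mkposreal r Hr); intros t Ht _; rewrite <- HPS by exact Ht.
  assert (E : forall s, x + (s - x) = s) by (intros; ring).
  now rewrite E.
- apply filterlim_comp with (2 := Hcv).
  intros P [eps HP]; exists eps; intros t Ht _; apply HP.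
  apply Rabs_lt_between'; apply Rabs_lt_between' in Ht; lra.
Qed.

Lemma is_hyp2F1_continuous_m1 (a b c : C) (G : C -> C) :
  is_hyp2F1 a b c G ->
  filterlim (fun t => Re (G (RtoC t))) (at_right (-1)) (locally (Re (G (RtoC (-1))))).
Proof.
intros [HG _]; apply analytic_at_continuous_right, HG.
intros [_ H]; simpl in H; lra.
Qed.

(** * The majorant of the Clausen coefficients *)

Definition clausen_major (al be c : R) (n : nat) : R :=
  binc al n * bmom be c (2 * n).

(** The duplication [(x + 2n)(x + 2n + 1) = 4 (x/2 + n)((x + 1)/2 + n)], for [x = be] and [x = c],
    gives the term ratio the shape of that of [coef3F2]. *)
Lemma clausen_major_S (al be c : R) (n : nat) : 0 < c ->
  clausen_major al be c (S n) =
  (al + INR n) * (be / 2 + INR n) * ((be + 1) / 2 + INR n) /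
  ((c / 2 + INR n) * ((c + 1) / 2 + INR n) * (1 + INR n)) * clausen_major al be c n.
Proof.
intros Hc; unfold clausen_major, binc, bmom.
replace (2 * S n)%nat with (S (S (2 * n))) by lia.
unfold rpoch; fold rpoch; rewrite S_INR, mult_INR; change (INR 2) with 2.
pose proof (pos_INR n).
pose proof (rpoch_pos c (2 * n) Hc); pose proof (rpoch_pos 1 n Rlt_0_1).
field; lra.
Qed.

(** Term ratios are compared: the denominators are the same positive reals, and the numerators obey
    the triangle inequality factor by factor. *)
Lemma coef3F2_le (a b : C) (c : R) (n : nat) : 0 < c ->
  Cmod (coef3F2 a (b / 2) ((b + 1) / 2) (RtoC (c / 2)) (RtoC ((c + 1) / 2)) n) <=
  clausen_major (Cmod a) (Cmod b) c n.
Proof.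
intros Hc; induction n as [|n IH].
- unfold coef3F2, clausen_major, binc, bmom; simpl.
  replace (1 * 1 * 1 / (1 * 1 * 1))%C with (RtoC 1) by (field; apply C1_nz).
  rewrite Cmod_1; right; field.
- rewrite clausen_major_S by exact Hc.
  pose proof (pos_INR n) as Hn.
  set (D := (c / 2 + INR n) * ((c + 1) / 2 + INR n) * (1 + INR n)).
  assert (HD : 0 < D) by (unfold D; repeat apply Rmult_lt_0_compat; lra).
  assert (HDC : RtoC D <> 0) by (intros E; apply RtoC_inj in E; lra).
  assert (HDE : RtoC D = ((RtoC (c / 2) + INR n) * (RtoC ((c + 1) / 2) + INR n) * (1 + INR n))%C).
  { unfold D; now rewrite !RtoC_mult, !RtoC_plus. }
  set (A := coef3F2 a (b / 2) ((b + 1) / 2) (RtoC (c / 2)) (RtoC ((c + 1) / 2)) n) in *.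
  replace (coef3F2 a (b / 2) ((b + 1) / 2) (RtoC (c / 2)) (RtoC ((c + 1) / 2)) (S n))
    with ((a + INR n) * (b / 2 + INR n) * ((b + 1) / 2 + INR n) / RtoC D * A)%C.
  2:{ unfold A, coef3F2; simpl poch.
      pose proof (poch_RtoC_neq_0 (c / 2) n ltac:(lra)).
      pose proof (poch_RtoC_neq_0 ((c + 1) / 2) n ltac:(lra)).
      pose proof (poch_RtoC_neq_0 1 n ltac:(lra)).
      rewrite HDE in HDC |- *.
      field; repeat split; auto; intros E; apply HDC; rewrite E; ring. }
  assert (Hn' : Cmod (INR n) = INR n) by (rewrite Cmod_R; now apply Rabs_pos_eq).
  assert (H2 : Cmod 2 = 2) by (rewrite Cmod_R; apply Rabs_pos_eq; lra).
  assert (H2nz : RtoC 2 <> 0) by (intros E; apply RtoC_inj in E; lra).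
  assert (Ha : Cmod (a + INR n) <= Cmod a + INR n).
  { rewrite <- Hn' at 2; apply Cmod_triangle. }
  assert (Hb : Cmod (b / 2 + INR n) <= Cmod b / 2 + INR n).
  { rewrite <- Hn' at 2; rewrite <- H2 at 2.
    rewrite <- Cmod_div by exact H2nz; apply Cmod_triangle. }
  assert (Hb1 : Cmod ((b + 1) / 2 + INR n) <= (Cmod b + 1) / 2 + INR n).
  { eapply Rle_trans; [apply Cmod_triangle|].
    rewrite Cmod_div, Hn', H2 by exact H2nz.
    apply Rplus_le_compat_r, Rmult_le_compat_r; [lra|].
    pose proof (Cmod_triangle b 1) as Ht; rewrite Cmod_1 in Ht; exact Ht. }
  rewrite Cmod_mult, Cmod_div, !Cmod_mult, Cmod_R, (Rabs_pos_eq D) by (auto; lra).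
  apply Rmult_le_compat; auto using Cmod_ge_0.
  + apply Rmult_le_pos; [|apply Rlt_le, Rinv_0_lt_compat; exact HD].
    repeat apply Rmult_le_pos; apply Cmod_ge_0.
  + apply Rmult_le_compat_r; [apply Rlt_le, Rinv_0_lt_compat; exact HD|].
    repeat apply Rmult_le_compat; auto using Cmod_ge_0.
    apply Rmult_le_pos; apply Cmod_ge_0.
Qed.

Lemma clausen_major_shift (al be c : R) (n : nat) : 0 < c ->
  INR (S n) * clausen_major al be c (S n) =
  al * rpoch be 2 / (c * (c + 1)) * clausen_major (al + 1) (be + 2) (c + 2) n.
Proof.
intros Hc; unfold clausen_major.
assert (H2 : forall x m, rpoch x (S (S m)) = rpoch x 2 * rpoch (x + 2) m).
{ intros x m; replace (x + 2) with (x + 1 + 1) by ring.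
  pose proof (rpoch_succ_shift x (S m)) as E1.
  pose proof (rpoch_succ_shift (x + 1) m) as E2.
  simpl rpoch at 2; rewrite Rmult_1_l, Rplus_0_r, Rmult_assoc.
  replace (x + INR 1) with (x + 1) by reflexivity; rewrite E2.
  change (rpoch x (S (S m))) with (rpoch x (S m) * (x + INR (S m))).
  rewrite <- E1; reflexivity. }
rewrite <- Rmult_assoc, binc_S.
replace (2 * S n)%nat with (S (S (2 * n))) by lia.
unfold bmom; rewrite (H2 be (2 * n)%nat), (H2 c (2 * n)%nat).
assert (E : al * binc (al + 1) n = (al + INR n) * binc al n).
{ unfold binc, Rdiv; rewrite <- !Rmult_assoc, rpoch_succ_shift; ring. }
rewrite <- E.
pose proof (rpoch_pos (c + 2) (2 * n) ltac:(lra)).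
replace (rpoch c 2) with (c * (c + 1)) by (simpl; ring).
field; lra.
Qed.

(** The origin of the denominator [(c - al) (c - al - be - 1)] in the hypothesis: each factor is one
    use of the functional equation of [Gamma]. *)
Lemma gauss_Gamma_shift (al be c : R) :
  0 < al -> 0 < be -> al + be + 1 < c ->
  rpoch be 2 * al / (c * (c + 1)) * gauss_Gamma (al + 1) (be + 2) (c + 2) =
  gauss_Gamma al be c * (al * rpoch be 2 / ((c - al) * (c - al - be - 1))).
Proof.
intros Hal Hbe Hc; unfold gauss_Gamma.
replace (c + 2 - (al + 1) - (be + 2)) with (c - al - be - 1) by ring.
replace (c + 2 - (al + 1)) with (c - al + 1) by ring.
replace (c + 2 - (be + 2)) with (c - be) by ring.
replace (Gamma (c - al - be)) with ((c - al - be - 1) * Gamma (c - al - be - 1)).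
2:{ rewrite <- Gamma_succ by lra; f_equal; ring. }
replace (c + 2) with (c + 1 + 1) by ring.
rewrite !Gamma_succ by lra.
pose proof (Gamma_pos (c - al) ltac:(lra)); pose proof (Gamma_pos (c - be) ltac:(lra)).
field; repeat split; lra.
Qed.

Theorem theorem2p1 :
  forall (a b : C) (c lam : R) (F G : C -> C),
    a <> 0 -> b <> 0 -> 0 < c -> c > Cmod a + Cmod b + 1 ->
    0 < lam <= 1 ->
    is_hyp2F1 (Cmod a + 1) (Cmod b + 2) (c - Cmod a + 1) F ->
    is_hyp2F1 (Cmod a) (Cmod b) (c - Cmod a) G ->
    Re (RtoC (Gamma c * Gamma (c - Cmod a - Cmod b)
              / (Gamma (c - Cmod a) * Gamma (c - Cmod b)))
        * (Cmod a * poch (Cmod b) 2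
             / RtoC ((c - Cmod a) * (c - Cmod a - Cmod b - 1))
             * F (RtoC (-1))
           + lam * G (RtoC (-1))))%C
      <= 2 * lam ->
    class_Sstar lam
      (fun z : C =>
         (z * hyp3F2 a (b / 2) ((b + 1) / 2)
                (RtoC (c / 2)) (RtoC ((c + 1) / 2)) z)%C).
Proof.
intros a b c lam F G Ha Hb Hc Hcab Hlam HF HG H.
apply Cmod_gt_0 in Ha; apply Cmod_gt_0 in Hb.
set (al := Cmod a) in *; set (be := Cmod b) in *.
rewrite <- RtoC_minus, <- !RtoC_plus in HF; rewrite <- RtoC_minus in HG.
rewrite poch_RtoC in H.
set (m := al * rpoch be 2 / ((c - al) * (c - al - be - 1))).
assert (Hm : (c - al) * (c - al - be - 1) <> 0) by (apply Rmult_integral_contrapositive; lra).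
change (Gamma c * Gamma (c - al - be) / (Gamma (c - al) * Gamma (c - be)))
  with (gauss_Gamma al be c) in H.
rewrite <- RtoC_mult, <- RtoC_div in H by exact Hm; fold m in H.
set (K := gauss_Gamma al be c) in *.
(* All other factors are real, so only the real parts of [F] and [G] at -1 enter. *)
replace (Re _) with (K * m * Re (F (RtoC (-1))) + lam * (K * Re (G (RtoC (-1))))) in H
  by (unfold Re; simpl; ring).
assert (HGle : forall M, sum_n (clausen_major al be c) M <= K * Re (G (RtoC (-1)))).
{ intros M; apply (sum_le_gauss_Gamma al be c (fun t => Re (G (RtoC t)))); try lra.
  - intros x Hx; apply is_hyp2F1_real_series; auto; lra.
  - now apply is_hyp2F1_continuous_m1 in HG. }
assert (HFle : forall M, sum_n (clausen_major (al + 1) (be + 2) (c + 2)) M <=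
  gauss_Gamma (al + 1) (be + 2) (c + 2) * Re (F (RtoC (-1)))).
{ intros M.
  apply (sum_le_gauss_Gamma (al + 1) (be + 2) (c + 2) (fun t => Re (F (RtoC t)))); try lra.
  - replace (c + 2 - (al + 1)) with (c - al + 1) by ring.
    intros x Hx; apply is_hyp2F1_real_series; auto; lra.
  - now apply is_hyp2F1_continuous_m1 in HF. }
assert (Hmaj : forall n, 0 < clausen_major al be c n).
{ intros; apply Rmult_lt_0_compat; [now apply binc_pos|apply bmom_pos; lra]. }
apply class_Sstar_of_coef with (b := clausen_major al be c); try lra.
- unfold coef3F2; simpl; field; apply C1_nz.
- unfold clausen_major, binc, bmom; simpl; field.
- apply Hmaj.
- intros n; now apply coef3F2_le.
- intros M.
  rewrite (sum_n_ext _ (fun k => INR k * clausen_major al be c k + lam * clausen_major al be c k))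
    by (intros; simpl; real_eq; ring).
  rewrite sum_n_plus_R, sum_n_scal_R.
  apply Rle_trans with (2 := H), Rplus_le_compat.
  2:{ apply Rmult_le_compat_l; [lra|apply HGle]. }
  (* One more nonnegative term is added, so that dropping the zero term at [k = 0] and shifting the
     index leaves a sum up to [M]. *)
  apply Rle_trans with (sum_n (fun k => INR k * clausen_major al be c k) (S M)).
  { rewrite sum_Sn; unfold plus; simpl AbelianMonoid.plus.
    pose proof (Rmult_le_pos _ _ (pos_INR (S M)) (Rlt_le _ _ (Hmaj (S M)))) as Hp.
    unfold AbelianMonoid.plus; simpl in *; lra. }
  rewrite sum_n_first; replace (INR 0 * _) with 0 by (simpl; ring); rewrite Rplus_0_l.
  rewrite (sum_n_ext _ (fun k => al * rpoch be 2 / (c * (c + 1)) *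
    clausen_major (al + 1) (be + 2) (c + 2) k)).
  2:{ intros; now apply clausen_major_shift. }
  rewrite sum_n_scal_R; unfold K, m.
  rewrite <- gauss_Gamma_shift by lra.
  rewrite (Rmult_comm (rpoch be 2) al), (Rmult_assoc _ (gauss_Gamma _ _ _)).
  apply Rmult_le_compat_l; [|apply HFle].
  pose proof (rpoch_pos be 2 Hb).
  apply Rlt_le, Rdiv_lt_0_compat; nra.
Qed.
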